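(* Let $n\ge 2$ be an integer and let $f:[0,\infty)\to\mathbb{R}$. Put $F(s)=\int_0^s f(t)\,dt$. Assume: (1) $f$ is continuous on $[0,\infty)$, continuously differentiable on $(0,\infty)$, and $f'\in L^1(0,1)$; (2) $f(0)=0$ and either there exist $\beta>B>0$ such that $f(s)>0$ for $s>B$, $f(s)\le 0$ for $s\in[0,B]$, $f(s)<0$ on $(0,\epsilon)$ for some $\epsilon>0$, and $\int_0^\beta f(t)\,dt=0$; or $\beta=B=0$ and $f(s)>0$ for $s>B$; (3) $\left(\frac{F}{f}\right)'(s)\ge\frac{n-2}{2n}$ for all $s>\beta$ (subcriticality); (4) $f(s)\le f'(s)(s-B)$ for all $s>B$, and $f(s)\not\equiv f'(s)(s-B)$ for $s\in[B,\beta]$ (superlinearity). Then the problem $$u''(r)+\frac{n-1}{r}u'(r)+f(u(r))=0,\quad r\in(a,b),\qquad u(a)=u(b)=0,$$ has at most one positive solution for every $a$ and $b$ with $0<a<b<\infty$.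
   Context: A positive solution is a classical solution $u\in C^2(a,b)\cap C^1[a,b]$ of the boundary value problem with $u(r)>0$ for all $r\in(a,b)$.
   Formalization: When β = B = 0 the second clause of (4) on [B,β] = {0} is undefined or never true; it is read as: f(s) = f'(s)s fails somewhere in every interval (0,e), since if f is linear near 0 uniqueness fails on some annulus. *)

(* Defs.v *)
From HB Require Import structures.
From mathcomp Require Import all_boot all_order all_algebra.
From mathcomp Require Import all_classical all_reals all_analysis.
Set Implicit Arguments.
Unset Strict Implicit.
Unset Printing Implicit Defensive.
Import Order.TTheory GRing.Theory Num.Theory.
Import numFieldNormedType.Exports.
Local Open Scope classical_set_scope.
Local Open Scope ring_scope.

(* The nonlinearity f : [0, +oo) -> R is a total function R -> R whose values
   on the negative numbers are never constrained. *)

Definition primitive0 (R : realType) (f : R -> R) (s : R) : R :=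
  \int[lebesgue_measure]_(t in `[0, s]) f t.

Definition regular_nonlinearity (R : realType) (f : R -> R) : Prop :=
  [/\ {within `[0, +oo[, continuous f},
      (forall s : R, 0 < s -> derivable f s 1 /\ {for s, continuous (derive1 f)}) &
      lebesgue_measure.-integrable `]0, 1[ (EFin \o derive1 f)].

Definition sign_condition (R : realType) (f : R -> R) (B beta : R) : Prop :=
  f 0 = 0 /\
  ([/\ 0 < B < beta,
       forall s : R, B < s -> 0 < f s,
       forall s : R, 0 <= s <= B -> f s <= 0,
       exists2 e : R, 0 < e & forall s : R, 0 < s < e -> f s < 0 &
       primitive0 f beta = 0]
   \/ [/\ beta = 0, B = 0 & forall s : R, B < s -> 0 < f s]).

Definition subcritical (R : realType) (n : nat) (f : R -> R) (beta : R) : Prop :=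
  forall s : R, beta < s ->
    (n%:R - 2) / (2 * n%:R) <= derive1 (fun t => primitive0 f t / f t) s.

(* "f(s) is not identically f'(s)(s - B) on [B, beta]".  When beta = B = 0 the
   interval is the single point 0, where f' need not exist and both sides
   vanish for any value of f'(0), so the pointwise reading can never hold
   (not even for f(s) = s^p).  There the condition is read on the germ at B+:
   the identity fails on every interval (B, B + e). *)
Definition not_identically_linear (R : realType) (f : R -> R)
    (B beta : R) : Prop :=
  (B < beta -> exists2 s : R, B <= s <= beta & f s <> derive1 f s * (s - B)) /\
  (B = beta -> forall e : R, 0 < e ->
     exists2 s : R, B < s < B + e & f s <> derive1 f s * (s - B)).

Definition superlinear (R : realType) (f : R -> R) (B beta : R) : Prop :=
  (forall s : R, B < s -> f s <= derive1 f s * (s - B)) /\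
  not_identically_linear f B beta.

Definition C2_open (R : realType) (a b : R) (u : R -> R) : Prop :=
  forall r : R, a < r < b ->
    [/\ derivable u r 1,
        derivable (derive1 u) r 1 &
        {for r, continuous (derive1 (derive1 u))}].

(* At the endpoints the derivative is one-sided, hence the difference
   quotients restricted to [a, b]: the values of u outside [a, b] play no
   role. *)
Definition C1_closed (R : realType) (a b : R) (u : R -> R) : Prop :=
  exists2 du : R -> R, {within `[a, b], continuous du} &
    forall r : R, a <= r <= b ->
      (u x - u r) / (x - r) @[x --> within `[a, b] r^'] --> du r.

Definition positive_solution (R : realType) (n : nat) (f : R -> R) (a b : R)
    (u : R -> R) : Prop :=
  [/\ C2_open a b u /\ C1_closed a b u,
      (forall r : R, a < r < b ->
         derive1 (derive1 u) r + (n%:R - 1) / r * derive1 u r + f (u r) = 0),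
      u a = 0 /\ u b = 0 &
      forall r : R, a < r < b -> 0 < u r].

(* Main.v *)
(* Two solutions are compared at equal heights, so that no differentiability
   with respect to initial data is needed. By the energy identity every
   critical point of a positive solution has u > beta, hence u rises to a single
   maximum M and then falls; on each of the two branches the inverse function
   r(s) and the speed p(s) = |u'| satisfy r' = 1 / p and
   p p' = -(n - 1) p / r - f(s), up to the sign of s.
   Equal slopes at a force u1 = u2. Suppose u1'(a) < u2'(a).
   (1) Rising branches: below beta, where F <= 0, the scaled energy
   r^(2n-2) (p^2 / 2 + F) of u2 stays the larger; then q = r^(n-1) p and the
   Erbe-Tang functional P = r^n (p^2 + 2F) + 2n (F / f) r^(n-1) u', which is
   nondecreasing in r by subcriticality, stay larger as well. So M1 < M2 and u2
   lies above u1 on the rising part.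
   (2) By superlinearity and the Wronskian of u1 - B and u2 - B, the falling
   branches meet at some height above B.
   (3) Below the first meeting height s, q2 > q1 and P2 > P1 imply p2 > p1 down
   to beta: P2 - P1 grows while q1 <= q2, and afterwards P2 / q2 > P1 / q1
   persists because q2 / q1 decreases. This gives r2 p2 > r1 p1 at beta.
   (4) Below beta, r^2 (p^2 / 2 + F) stays larger for u2, so r1 - r2 increases
   strictly as the height decreases to 0, which contradicts
   r1(0) = r2(0) = b. *)

Require Import Defs.
From HB Require Import structures.
From mathcomp Require Import all_boot all_order all_algebra.
From mathcomp Require Import all_classical all_reals all_analysis.
From mathcomp Require Import ring lra.
Set Implicit Arguments.
Unset Strict Implicit.
Unset Printing Implicit Defensive.
Import Order.TTheory GRing.Theory Num.Theory.
Import numFieldNormedType.Exports.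
Local Open Scope classical_set_scope.
Local Open Scope ring_scope.

Section Calculus.
Context {R : realType}.
Implicit Types (f g D : R -> R) (a b c d x y l : R).

Lemma cont_sub a b c d f : a <= c -> d <= b ->
  {within `[a, b], continuous f} -> {within `[c, d], continuous f}.
Proof.
move=> ac db; apply: continuous_subspaceW => x /=.
by rewrite !in_itv/= => /andP[cx xd]; rewrite (le_trans ac cx) (le_trans xd db).
Qed.

Lemma cont_cst a b (k : R) : {within `[a, b], continuous (fun=> k)}.
Proof. by apply: continuous_subspaceT => x; exact: cvg_cst. Qed.

Lemma cont_id a b : {within `[a, b], continuous (fun x : R => x)}.
Proof. by apply: continuous_subspaceT => x; exact: cvg_id. Qed.

Lemma contD a b f g : {within `[a, b], continuous f} ->
  {within `[a, b], continuous g} ->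
  {within `[a, b], continuous (fun x => f x + g x)}.
Proof. by move=> cf cg x; apply: cvgD; [exact: cf|exact: cg]. Qed.

Lemma contN a b f : {within `[a, b], continuous f} ->
  {within `[a, b], continuous (fun x => - f x)}.
Proof. by move=> cf x; apply: cvgN; exact: cf. Qed.

Lemma contB a b f g : {within `[a, b], continuous f} ->
  {within `[a, b], continuous g} ->
  {within `[a, b], continuous (fun x => f x - g x)}.
Proof. by move=> cf cg; apply: contD => //; exact: contN. Qed.

Lemma contM a b f g : {within `[a, b], continuous f} ->
  {within `[a, b], continuous g} ->
  {within `[a, b], continuous (fun x => f x * g x)}.
Proof. by move=> cf cg x; apply: cvgM; [exact: cf|exact: cg]. Qed.

Lemma contX a b f k : {within `[a, b], continuous f} ->
  {within `[a, b], continuous (fun x => f x ^+ k)}.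
Proof.
move=> cf; elim: k => [|k IH].
  by have -> : (fun x => f x ^+ 0) = (fun=> 1) by []; exact: cont_cst.
have -> : (fun x => f x ^+ k.+1) = (fun x => f x * f x ^+ k).
  by apply/funext => x; rewrite exprS.
exact: contM.
Qed.

Lemma cont_min a b f g : {within `[a, b], continuous f} ->
  {within `[a, b], continuous g} ->
  {within `[a, b], continuous (fun x => Num.min (f x) (g x))}.
Proof.
move=> cf cg; have -> : (fun x => Num.min (f x) (g x)) = f \min g by [].
by move=> x; apply: continuous_min; [exact: cf|exact: cg].
Qed.

Lemma cont_comp a b c d f g : {within `[a, b], continuous f} ->
  {within `[c, d], continuous g} ->
  (forall x, c <= x <= d -> a <= g x <= b) ->
  {within `[c, d], continuous (fun x => f (g x))}.
Proof.
move=> /subspace_continuousP cf /subspace_continuousP cg gab.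
apply/subspace_continuousP => x xcd.
have gx : `[a, b]%classic (g x) by rewrite /= in_itv/= gab// -(in_itv `[c, d]%O).
apply: (cvg_comp g f _ (cf _ gx)).
move=> A; rewrite /within/= => /(cg x xcd).
rewrite /nbhs/= /within/=; apply: filterS => y yA ycd.
by apply: yA => //=; rewrite in_itv/= gab// -(in_itv `[c, d]%O).
Qed.

Lemma cont_near_pos a b f x : {within `[a, b], continuous f} ->
  a <= x <= b -> 0 < f x ->
  exists2 e, 0 < e & forall y, a <= y <= b -> `|y - x| < e -> 0 < f y.
Proof.
move=> /subspace_continuousP cf xab fx0.
have xab' : `[a, b]%classic x by rewrite /= in_itv.
have /cvgrPdist_lt /(_ (f x) fx0) := cf x xab'.
rewrite /prop_near1 /nbhs/= /within/= => -[e /= e0 He].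
exists e => // y yab yx.
have := He y; rewrite /ball_/= distrC => /(_ yx); rewrite in_itv/= => /(_ yab).
by rewrite ltr_norml => /andP[_]; rewrite ltrBlDr ltrDl.
Qed.

Lemma left_point c x e : c < x -> 0 < e ->
  exists m, [/\ c < m, m < x & x - e < m].
Proof.
move=> cx e0; exists ((Num.max c (x - e) + x) / 2).
have : Num.max c (x - e) < x by rewrite gt_max cx/=; lra.
have : c <= Num.max c (x - e) by rewrite le_max lexx.
have : x - e <= Num.max c (x - e) by rewrite le_max lexx orbT.
by move: (Num.max _ _) => m *; split; lra.
Qed.

Lemma right_point x d e : x < d -> 0 < e ->
  exists y, [/\ x < y, y < x + e & y < d].
Proof.
move=> xd e0; have [|y [h1 h2 h3]] := @left_point (- d) (- x) e _ e0.
  by rewrite ltrN2.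
by exists (- y); split; lra.
Qed.

Lemma first_exit D c d : c <= d -> {within `[c, d], continuous D} ->
  0 < D c -> D d <= 0 ->
  exists x, [/\ c < x <= d, D x = 0 & forall y, c <= y < x -> 0 < D y].
Proof.
move=> cd cD Dc Dd.
pose S : set R := [set y | c <= y <= d /\ D y <= 0].
have Sd : S d by split; rewrite ?cd ?lexx.
have lbS : lbound S c by move=> y [/andP[]].
have hiS : has_inf S by split; [exists d|exists c].
pose x := inf S.
have cx : c <= x by apply: lb_le_inf => //; exists d.
have xd : x <= d by apply: ge_inf => //; exists c.
have pos y : c <= y < x -> 0 < D y.
  move=> /andP[cy yx]; rewrite ltNge; apply/negP => Dy.
  have : x <= y.
    apply: ge_inf; first by exists c.
    by split => //; rewrite cy (le_trans (ltW yx)).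
  by rewrite leNgt yx.
have Dx : D x <= 0.
  rewrite leNgt; apply/negP => Dx.
  have [e e0 He] := cont_near_pos cD (introT andP (conj cx xd)) Dx.
  have [y [/andP[cy yd] Dy] yxe] := inf_adherent e0 hiS.
  have xy : x <= y by apply: ge_inf; [exists c|split => //; rewrite cy].
  have := He y; rewrite cy yd ger0_norm ?subr_ge0// ltrBlDl => /(_ isT yxe).
  by rewrite ltNge Dy.
have ltcx : c < x.
  by rewrite lt_neqAle cx andbT; apply/eqP => cx'; rewrite cx' ltNge Dx in Dc.
exists x; split => //; first by rewrite ltcx.
apply/eqP; rewrite eq_le Dx/= leNgt; apply/negP => Dx0.
have Nx0 : 0 < - D x by rewrite oppr_gt0.
have [e e0 He] := cont_near_pos (contN cD) (introT andP (conj cx xd)) Nx0.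
have [m [cm mx xem]] := left_point ltcx e0.
have := He m; rewrite (ltW cm) (le_trans (ltW mx) xd) => /(_ isT).
rewrite ltr0_norm ?subr_lt0// opprB.
have := pos m; rewrite (ltW cm) mx => /(_ isT).
move=> ? H; have : x - m < e by lra.
by move/H; lra.
Qed.

Lemma mono_ge f df c d : c <= d -> {within `[c, d], continuous f} ->
  (forall x, c < x < d -> is_derive x 1 f (df x)) ->
  (forall x, c < x < d -> 0 <= df x) -> f c <= f d.
Proof.
rewrite le_eqVlt => /predU1P[->//|cd] cf df_ df0.
have [z] : exists2 z, z \in `]c, d[ & f d - f c = df z * (d - c).
  by apply: MVT => // x; rewrite in_itv/=; exact: df_.
rewrite in_itv/= => /df0 dz e; rewrite -subr_ge0 e mulr_ge0// subr_ge0 ltW//.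
Qed.

Lemma mono_gt f df c d : c < d -> {within `[c, d], continuous f} ->
  (forall x, c < x < d -> is_derive x 1 f (df x)) ->
  (forall x, c < x < d -> 0 < df x) -> f c < f d.
Proof.
move=> cd cf df_ df0.
have [z] : exists2 z, z \in `]c, d[ & f d - f c = df z * (d - c).
  by apply: MVT => // x; rewrite in_itv/=; exact: df_.
rewrite in_itv/= => /df0 dz e; rewrite -subr_gt0 e mulr_gt0// subr_gt0//.
Qed.

Lemma der_pos_near f x l : is_derive x 1 f l -> 0 < l ->
  exists2 e, 0 < e & (forall y, x < y < x + e -> f x < f y) /\
                     (forall y, x - e < y < x -> f y < f x).
Proof.
move=> [df fl] l0.
have := df; rewrite /derivable => /cvg_ex[l' hl'].
have ll' : l' = l by rewrite -fl; apply/esym/cvg_lim.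
move: hl'; rewrite ll' => /cvgrPdist_lt /(_ l l0).
rewrite /prop_near1 /nbhs/= /dnbhs/= /within/= => -[e /= e0 He].
have key h : `|h| < e -> h != 0 -> 0 < h^-1 * (f (h + x) - f x).
  move=> he h0; have := He h; rewrite /ball_/= sub0r normrN => /(_ he h0).
  rewrite ltr_norml => /andP[_]; rewrite /GRing.scale/= mulr1.
  by rewrite ltrBlDr ltrDl.
exists e => //; split => y /andP[y1 y2].
- have := key (y - x); rewrite subrK ger0_norm ?subr_ge0 ?ltW// subr_eq0 gt_eqF//.
  rewrite ltrBlDl => /(_ y2 isT); rewrite pmulr_rgt0 ?subr_gt0//.
  by rewrite invr_gt0 subr_gt0.
- have := key (y - x); rewrite subrK ler0_norm ?subr_le0 ?ltW// subr_eq0 lt_eqF//.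
  rewrite opprB ltrBlDl -ltrBlDr => /(_ y1 isT); rewrite nmulr_rgt0 ?subr_lt0//.
  by rewrite invr_lt0 subr_lt0.
Qed.

Lemma derC (k : R) x : is_derive x 1 (fun=> k) 0.
Proof. exact: is_derive_cst. Qed.

Lemma derI x : is_derive x 1 (fun y : R => y) 1.
Proof. exact: is_derive_id. Qed.

Lemma derD f g x (df dg : R) : is_derive x 1 f df -> is_derive x 1 g dg ->
  is_derive x 1 (fun y => f y + g y) (df + dg).
Proof. by move=> ? ?; exact: is_deriveD. Qed.

Lemma derN f x (df : R) : is_derive x 1 f df -> is_derive x 1 (fun y => - f y) (- df).
Proof. by move=> ?; exact: is_deriveN. Qed.

Lemma derB f g x (df dg : R) : is_derive x 1 f df -> is_derive x 1 g dg ->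
  is_derive x 1 (fun y => f y - g y) (df - dg).
Proof. by move=> ? ?; exact: is_deriveB. Qed.

Lemma derM f g x (df dg : R) : is_derive x 1 f df -> is_derive x 1 g dg ->
  is_derive x 1 (fun y => f y * g y) (f x * dg + g x * df).
Proof. by move=> ? ?; exact: is_deriveM. Qed.

Lemma derX f k x (df : R) : is_derive x 1 f df ->
  is_derive x 1 (fun y => f y ^+ k) (k%:R * f x ^+ k.-1 * df).
Proof.
move=> h; have -> : (fun y => f y ^+ k) = f ^+ k.
  by apply/funext => y; rewrite fctE.
exact: is_deriveX.
Qed.

Lemma derV f x (df : R) : f x != 0 -> is_derive x 1 f df ->
  is_derive x 1 (fun y => (f y)^-1) (- (f x ^- 2 * df)).
Proof.
by move=> f0 h; apply: is_derive_eq (is_deriveV f0 h) _; rewrite scaleNr.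
Qed.

Lemma der_comp f g x (df dg : R) : is_derive (g x) 1 f df -> is_derive x 1 g dg ->
  is_derive x 1 (fun y => f (g y)) (df * dg).
Proof. by move=> hf hg; exact: is_derive1_comp. Qed.

Lemma der_cont f x (df : R) : is_derive x 1 f df -> {for x, continuous f}.
Proof.
move=> h; apply: differentiable_continuous; apply/derivable1_diffP.
exact: ex_derive.
Qed.

Lemma der_cont_on f df a b : (forall x, a <= x <= b -> is_derive x 1 f (df x)) ->
  {within `[a, b], continuous f}.
Proof.
move=> h; apply: derivable_within_continuous => x; rewrite in_itv/= => /h ?.
exact: ex_derive.
Qed.

Lemma contV a b f : {within `[a, b], continuous f} ->
  (forall x, a <= x <= b -> f x != 0) ->
  {within `[a, b], continuous (fun x => (f x)^-1)}.
Proof.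
move=> /subspace_continuousP cf f0; apply/subspace_continuousP => x xab.
by apply: cvgV; [apply: f0; move: xab; rewrite /= in_itv|exact: cf].
Qed.

Lemma cont_left_ge0 D c x : c < x -> {within `[c, x], continuous D} ->
  (forall y, c < y < x -> 0 <= D y) -> 0 <= D x.
Proof.
move=> cx cD D0; rewrite leNgt; apply/negP => Dx.
have xcx : c <= x <= x by rewrite lexx ltW.
have [|e e0 He] := cont_near_pos (contN cD) xcx; first by rewrite oppr_gt0.
have [m [cm mx xem]] := left_point cx e0.
have := He m; rewrite !ltW// ltr0_norm ?subr_lt0// oppr_gt0 => /(_ isT) H.
have : D m < 0 by apply: H; lra.
by rewrite ltNge D0// cm.
Qed.

End Calculus.

Section Curves.
Context {R : realType}.
Implicit Types (g G r p : R -> R) (c d x : R) (N i : nat).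

(* A monotone branch of a solution in dimension N.+2, parametrised by the
   height sigma = u (increasing branch) or sigma = - u (decreasing branch):
   r is the inverse function and p = |u'|. *)
Record curve N g c d r p : Prop := Curve {
  cv_contr : {within `[c, d], continuous r};
  cv_contp : {within `[c, d], continuous p};
  cv_derr : forall x, c < x < d -> is_derive x 1 r (p x)^-1;
  cv_derp : forall x, c < x < d ->
    is_derive x 1 p (- (N.+1%:R / r x) - g x / p x);
  cv_r0 : forall x, c <= x <= d -> 0 < r x;
  cv_p0 : forall x, c < x < d -> 0 < p x;
  cv_p0' : forall x, c <= x <= d -> 0 <= p x }.

Lemma curve_sub N g c d r p c' d' : c <= c' -> d' <= d ->
  curve N g c d r p -> curve N g c' d' r p.
Proof.
move=> cc dd [cr cp dr dp r0 p0 p0'].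
have h x : c' < x < d' -> c < x < d.
  by move=> /andP[? ?]; rewrite (le_lt_trans cc)// (lt_le_trans _ dd).
have h' x : c' <= x <= d' -> c <= x <= d.
  by move=> /andP[? ?]; rewrite (le_trans cc)// (le_trans _ dd).
split.
- exact: cont_sub cr.
- exact: cont_sub cp.
- by move=> x /h /dr.
- by move=> x /h /dp.
- by move=> x /h' /r0.
- by move=> x /h /p0.
- by move=> x /h' /p0'.
Qed.

Definition energy G p x := p x ^+ 2 / 2 + G x.

Lemma cont_energy G p c d : {within `[c, d], continuous p} ->
  {within `[c, d], continuous G} -> {within `[c, d], continuous (energy G p)}.
Proof.
move=> cp cG; apply: (contD _ cG).
by apply: (contM (contX (k := 2) cp)); exact: cont_cst.
Qed.

Lemma der_energy N g G c d r p x : curve N g c d r p -> c < x < d ->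
  is_derive x 1 G (g x) ->
  is_derive x 1 (energy G p) (- (N.+1%:R * p x / r x)).
Proof.
move=> C xcd dG; have p0 := cv_p0 C xcd.
have r0 : 0 < r x by apply: (cv_r0 C); case/andP: xcd => /ltW -> /ltW ->.
apply: is_derive_eq (derD (derM (derX 2 (cv_derp C xcd)) (derC 2^-1 x)) dG) _.
by rewrite /=; field; rewrite !gt_eqF.
Qed.

Lemma der_rX k N g c d r p x : curve N g c d r p -> c < x < d ->
  is_derive x 1 (fun x => r x ^+ k.+1) (k.+1%:R * r x ^+ k / p x).
Proof. by move=> C xcd; exact: (is_derive_eq (derX k.+1 (cv_derr C xcd)) erefl). Qed.

Definition scaled_energy i G r p x := (r x ^+ i.+1) ^+ 2 * energy G p x.

Lemma cont_scaled_energy i N g G c d r p : curve N g c d r p ->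
  {within `[c, d], continuous G} ->
  {within `[c, d], continuous (scaled_energy i G r p)}.
Proof.
move=> C cG; apply: contM; first exact: contX (contX (cv_contr C)).
exact: cont_energy (cv_contp C) cG.
Qed.

Definition scaled_flux N i (e r p : R) :=
  r ^+ i * r ^+ i.+1 * (N.+1%:R * p - 2 * i.+1%:R * e / p).

Lemma der_scaled_energy i N g G c d r p x : curve N g c d r p -> c < x < d ->
  is_derive x 1 G (g x) ->
  is_derive x 1 (scaled_energy i G r p)
    (- scaled_flux N i (energy G p x) (r x) (p x)).
Proof.
move=> C xcd dG; have p0 := cv_p0 C xcd.
have r0 : 0 < r x by apply: (cv_r0 C); case/andP: xcd => /ltW -> /ltW ->.
apply: is_derive_eq
  (derM (derX 2 (der_rX i C xcd)) (der_energy C xcd dG)) _.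
rewrite /scaled_flux /= expr1 [r x ^+ i.+1]exprS.
by field; rewrite !gt_eqF.
Qed.

Lemma scaled_energy_speed k (r1 r2 p1 p2 h : R) : 0 < r2 -> r2 <= r1 ->
  0 <= p1 -> 0 <= p2 -> 0 <= p1 ^+ 2 / 2 + h ->
  (r1 ^+ k) ^+ 2 * (p1 ^+ 2 / 2 + h) < (r2 ^+ k) ^+ 2 * (p2 ^+ 2 / 2 + h) ->
  p1 < p2.
Proof.
move=> r20 r21 p10 p20 e1.
set a1 := r1 ^+ k; set a2 := r2 ^+ k => A12.
have a20 : 0 < a2 by rewrite exprn_gt0.
have a21 : a2 <= a1 by apply: lerXn2r => //; rewrite nnegrE ltW// (lt_le_trans r20).
have : a2 ^+ 2 * (p1 ^+ 2 / 2 + h) < a2 ^+ 2 * (p2 ^+ 2 / 2 + h).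
  apply: le_lt_trans A12; apply: ler_wpM2r => //; apply: lerXn2r => //.
    by rewrite nnegrE ltW.
  by rewrite nnegrE (le_trans (ltW a20)).
rewrite ltr_pM2l ?exprn_gt0// ltrD2r ltr_pM2r ?invr_gt0//.
by rewrite ltr_pXn2r.
Qed.

Lemma scaled_flux_lt N i (r1 r2 p1 p2 h : R) : (i <= N)%N ->
  0 < r2 -> r2 < r1 -> 0 < p1 -> 0 < p2 -> h < 0 -> 0 <= p1 ^+ 2 / 2 + h ->
  (r1 ^+ i.+1) ^+ 2 * (p1 ^+ 2 / 2 + h) = (r2 ^+ i.+1) ^+ 2 * (p2 ^+ 2 / 2 + h) ->
  scaled_flux N i (p2 ^+ 2 / 2 + h) r2 p2 < scaled_flux N i (p1 ^+ 2 / 2 + h) r1 p1.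
Proof.
move=> iN r20 r21 p10 p20 h0 e10; rewrite /scaled_flux.
have r10 := lt_trans r20 r21.
have a20 : 0 < r2 ^+ i by rewrite exprn_gt0.
have a21 : r2 ^+ i <= r1 ^+ i by apply: lerXn2r; rewrite ?nnegrE ltW.
have b20 : 0 < r2 ^+ i.+1 by rewrite exprn_gt0.
have b21 : r2 ^+ i.+1 < r1 ^+ i.+1 by rewrite ltr_pXn2r// nnegrE ltW.
move: (r2 ^+ i) (r1 ^+ i) (r2 ^+ i.+1) (r1 ^+ i.+1) a20 a21 b20 b21.
move=> a2 a1 b2 b1 a20 a21 b20 b21 AE.
have b10 := lt_trans b20 b21.
set A := b1 ^+ 2 * (p1 ^+ 2 / 2 + h).
have A0 : 0 <= A by rewrite mulr_ge0// exprn_ge0// ltW.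
have k1 : i.+1%:R <= N.+1%:R :> R by rewrite ler_nat.
have k0 : 0 < i.+1%:R :> R by rewrite ltr0n.
move: (N.+1%:R : R) (i.+1%:R : R) k1 k0 => n k k1 k0.
have n0 := lt_le_trans k0 k1.
pose y1 := b1 * p1; pose y2 := b2 * p2.
have y10 : 0 < y1 by rewrite mulr_gt0.
have y20 : 0 < y2 by rewrite mulr_gt0.
have E1 : y1 ^+ 2 = 2 * A - 2 * b1 ^+ 2 * h by rewrite /y1 /A; field.
have E2 : y2 ^+ 2 = 2 * A - 2 * b2 ^+ 2 * h by rewrite /y2 /A AE; field.
have y21 : y2 < y1.
  have : b1 ^+ 2 * h < b2 ^+ 2 * h.
    by rewrite ltr_nM2r// ltr_pXn2r// nnegrE ltW.
  move=> bh; have : y2 ^+ 2 < y1 ^+ 2 by rewrite E1 E2; lra.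
  by rewrite ltr_pXn2r// nnegrE ltW.
have -> : a1 * b1 * (n * p1 - 2 * k * (p1 ^+ 2 / 2 + h) / p1) =
    a1 * ((n * y1 ^+ 2 - 2 * k * A) / y1).
  by rewrite /y1 /A; field; rewrite !gt_eqF.
have -> : a2 * b2 * (n * p2 - 2 * k * (p2 ^+ 2 / 2 + h) / p2) =
    a2 * ((n * y2 ^+ 2 - 2 * k * A) / y2).
  by rewrite /y2 /A AE; field; rewrite !gt_eqF.
have pos : 0 < (n * y1 ^+ 2 - 2 * k * A) / y1.
  rewrite divr_gt0// E1.
  have : k * A <= n * A by rewrite ler_wpM2r.
  have : n * (b1 ^+ 2 * h) < 0 by rewrite pmulr_rlt0// pmulr_rlt0// exprn_gt0.
  by lra.
apply: (@lt_le_trans _ _ (a2 * ((n * y1 ^+ 2 - 2 * k * A) / y1))); last first.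
  by rewrite ler_pM2r.
rewrite ltr_pM2l// -subr_gt0.
have -> : (n * y1 ^+ 2 - 2 * k * A) / y1 - (n * y2 ^+ 2 - 2 * k * A) / y2 =
   (y1 - y2) * (n + 2 * k * A / (y1 * y2)) by field; rewrite !gt_eqF.
rewrite mulr_gt0 ?subr_gt0// ltr_wpDr// divr_ge0// ?mulr_ge0// ltW//.
Qed.

End Curves.

Section Phases.
Context {R : realType}.
Implicit Types (g G r p k : R -> R) (c d x : R) (N i : nat).

Lemma curve_gap N g c d r1 p1 r2 p2 : c < d ->
  curve N g c d r1 p1 -> curve N g c d r2 p2 ->
  (forall x, c < x < d -> p1 x < p2 x) ->
  r1 c - r2 c < r1 d - r2 d.
Proof.
move=> cd C1 C2 p12.
apply: (@mono_gt _ (fun x => r1 x - r2 x) (fun x => (p1 x)^-1 - (p2 x)^-1) c d cd).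
- by apply: contB; [exact: (cv_contr C1)|exact: (cv_contr C2)].
- by move=> x xcd; exact: derB (cv_derr C1 xcd) (cv_derr C2 xcd).
- move=> x xcd; rewrite subr_gt0 ltf_pV2 ?posrE ?(cv_p0 C1)// ?(cv_p0 C2)//.
  exact: p12.
Qed.

Lemma gap_lt N g c d r1 p1 r2 p2 x :
  curve N g c d r1 p1 -> curve N g c d r2 p2 -> c < x <= d ->
  (forall y, c <= y < x -> p1 y < p2 y) -> r2 c <= r1 c -> r2 x < r1 x.
Proof.
move=> C1 C2 /andP[cx xd] h r21.
have := curve_gap cx (curve_sub (lexx c) xd C1) (curve_sub (lexx c) xd C2).
rewrite -subr_gt0 => H; rewrite -subr_gt0.
suff : 0 < r1 x - r2 x - (r1 c - r2 c) by lra.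
by apply: H => y /andP[cy yx]; apply: h; rewrite ltW.
Qed.

Section Two.
Context (N : nat) (g : R -> R) (c d : R) (r1 p1 r2 p2 : R -> R).
Context (cd : c < d).
Context (C1 : curve N g c d r1 p1).
Context (C2 : curve N g c d r2 p2).

(* Where G < 0, at equal scaled energies the larger radius has the larger flux
   for every exponent 2 (i + 1) between 2 and 2 (n - 1) (scaled_flux_lt); the
   two ends of this range are used, i = N on the rising and i = 0 on the
   falling branches. *)
Lemma energy_cmp i G : (i <= N)%N ->
  {within `[c, d], continuous G} ->
  (forall x, c < x < d -> is_derive x 1 G (g x)) ->
  (forall x, c < x < d -> G x < 0) ->
  (forall x, c <= x <= d -> 0 <= energy G p1 x) ->
  r2 c <= r1 c ->
  scaled_energy i G r1 p1 c < scaled_energy i G r2 p2 c ->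
  forall x, c <= x < d ->
   [/\ scaled_energy i G r1 p1 x < scaled_energy i G r2 p2 x,
       p1 x < p2 x & c < x -> r2 x < r1 x].
Proof.
move=> iN cG dG G0 e10 r21 A12.
pose D x := Num.min (scaled_energy i G r2 p2 x - scaled_energy i G r1 p1 x)
                    (p2 x - p1 x).
have speed x : c <= x <= d -> r2 x <= r1 x ->
    scaled_energy i G r1 p1 x < scaled_energy i G r2 p2 x -> p1 x < p2 x.
  move=> xcd r21x; apply: scaled_energy_speed => //.
  - exact: (cv_r0 C2).
  - exact: (cv_p0' C1).
  - exact: (cv_p0' C2).
  - exact: e10.
have cA1 := cont_scaled_energy (i := i) C1 cG.
have cA2 := cont_scaled_energy (i := i) C2 cG.
have cD : {within `[c, d], continuous D}.
  apply: cont_min; first by apply: contB.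
  by apply: contB; [exact: (cv_contp C2)|exact: (cv_contp C1)].
have Dpos x : 0 < D x ->
    scaled_energy i G r1 p1 x < scaled_energy i G r2 p2 x /\ p1 x < p2 x.
  by rewrite /D lt_min !subr_gt0 => /andP.
have Dc : 0 < D c.
  by rewrite /D lt_min !subr_gt0 A12 speed// lexx (ltW cd).
suff main x : c <= x < d -> 0 < D x.
  move=> x /andP[cx xd]; have [|? ?] := Dpos x; first by rewrite main// cx.
  split => // cx'; apply: (gap_lt C1 C2) => //; first by rewrite cx' (ltW xd).
  move=> y /andP[cy yx]; have [|//] := Dpos y.
  by rewrite main// cy (lt_trans yx).
move=> /andP[cx xd]; rewrite ltNge; apply/negP => Dx.
have [z [/andP[cz zx] Dz zpos]] := first_exit cx (cont_sub (lexx c) (ltW xd) cD) Dc Dx.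
have zd := le_lt_trans zx xd.
have zcd : c <= z <= d by rewrite (ltW cz) (ltW zd).
have r21z : r2 z < r1 z.
  apply: (gap_lt C1 C2) => //; first by rewrite cz (ltW zd).
  by move=> y /zpos /Dpos[].
have := speed z zcd (ltW r21z).
have [lt|ge _] := ltP (scaled_energy i G r1 p1 z) (scaled_energy i G r2 p2 z).
  move=> /(_ isT) ps; move: Dz; by apply/eqP; rewrite gt_eqF// /D lt_min !subr_gt0 lt.
have zoo : c < z < d by rewrite cz.
have dS := derB (der_scaled_energy i C1 zoo (dG _ zoo))
                (der_scaled_energy i C2 zoo (dG _ zoo)).
have Eq : scaled_energy i G r1 p1 z = scaled_energy i G r2 p2 z.
  apply/eqP; rewrite eq_le ge andbT -subr_ge0.
  apply: (@cont_left_ge0 _ (fun y => scaled_energy i G r2 p2 y -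
                                     scaled_energy i G r1 p1 y) c) => //.
    by apply: (cont_sub (lexx c) (ltW zd)); exact: contB.
  move=> y /andP[cy yz]; have := zpos y; rewrite (ltW cy) yz => /(_ isT).
  by move=> /Dpos[A _]; rewrite subr_ge0 ltW.
have flux : scaled_flux N i (energy G p2 z) (r2 z) (p2 z) <
            scaled_flux N i (energy G p1 z) (r1 z) (p1 z).
  apply: scaled_flux_lt => //.
  - exact: (cv_r0 C2).
  - exact: (cv_p0 C1).
  - exact: (cv_p0 C2).
  - exact: G0.
  - exact: e10.
have S'neg : 0 < - (- scaled_flux N i (energy G p1 z) (r1 z) (p1 z) -
   - scaled_flux N i (energy G p2 z) (r2 z) (p2 z)) by lra.
have [e e0 [_ He]] := der_pos_near (derN dS) S'neg.
have [m [cm mz me]] := left_point cz e0.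
have := He m; rewrite mz Eq subrr oppr0 andbT.
have := zpos m; rewrite (ltW cm) mz => /(_ isT) /Dpos[A _].
move=> H; have : z - e < m by lra.
by move/H; lra.
Qed.

Lemma energy_cmp_end G :
  {within `[c, d], continuous G} ->
  (forall x, c < x < d -> is_derive x 1 G (g x)) ->
  (forall x, c < x < d -> G x < 0) -> G d = 0 -> 0 < p1 d ->
  (forall x, c <= x <= d -> 0 <= energy G p1 x) ->
  r2 c <= r1 c ->
  scaled_energy N G r1 p1 c < scaled_energy N G r2 p2 c ->
  scaled_energy N G r1 p1 d < scaled_energy N G r2 p2 d /\ r2 d < r1 d.
Proof.
move=> cG dG G0 Gd p1d e10 r21 A12.
have cmp := energy_cmp (leqnn N) cG dG G0 e10 r21 A12.
have r21d : r2 d < r1 d.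
  by apply: (gap_lt C1 C2) => //; [rewrite cd lexx|move=> y /cmp[]].
split => //.
have cA1 := cont_scaled_energy (i := N) C1 cG.
have cA2 := cont_scaled_energy (i := N) C2 cG.
rewrite lt_neqAle -subr_ge0 (cont_left_ge0 cd (contB cA2 cA1)) ?andbT; last first.
  by move=> y /andP[cy yd]; rewrite subr_ge0 ltW//; case: (cmp y); rewrite ?(ltW cy).
apply/eqP => Ad.
have cdd : c <= d <= d by rewrite (ltW cd) lexx.
have r2d := cv_r0 C2 cdd; have r1d := lt_trans r2d r21d.
pose W x := r1 x ^+ N * r1 x ^+ N.+1 * p2 x - r2 x ^+ N * r2 x ^+ N.+1 * p1 x.
have cW : {within `[c, d], continuous W}.
  apply: contB; apply: contM (cv_contp _); try exact: C1; try exact: C2.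
    by apply: contM; exact: contX (cv_contr C1).
  by apply: contM; exact: contX (cv_contr C2).
have Wd : 0 < W d.
  have a21 : r2 d ^+ N <= r1 d ^+ N by apply: lerXn2r; rewrite ?nnegrE ltW.
  have a2 : 0 < r2 d ^+ N by rewrite exprn_gt0.
  have b21 : r2 d ^+ N.+1 < r1 d ^+ N.+1 by rewrite ltr_pXn2r// nnegrE ltW.
  have b2 : 0 < r2 d ^+ N.+1 by rewrite exprn_gt0.
  have p20 := cv_p0' C2 cdd.
  move: Ad; rewrite /scaled_energy /energy Gd !addr0 => Ad.
  have {}Ad : (r1 d ^+ N.+1 * p1 d) ^+ 2 = (r2 d ^+ N.+1 * p2 d) ^+ 2.
    by rewrite !exprMn; lra.
  rewrite /W; move: a21 a2 b21 b2 Ad.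
  move: (r1 d ^+ N) (r2 d ^+ N) (r1 d ^+ N.+1) (r2 d ^+ N.+1).
  move=> a1 a2 b1 b2 a21 a20 b21 b20.
  have b10 := lt_trans b20 b21.
  move/eqP; rewrite eqrXn2//; last 2 first.
    by rewrite mulr_ge0// ltW.
    by rewrite mulr_ge0// ltW.
  move=> /eqP E.
  have p12 : p1 d < p2 d.
    rewrite ltNge; apply/negP => p21; have : b2 * p2 d <= b2 * p1 d by rewrite ler_pM2l.
    have : b2 * p1 d < b1 * p1 d by rewrite ltr_pM2r.
    by lra.
  rewrite subr_gt0; apply: (@lt_trans _ _ (a2 * b2 * p2 d)).
    by rewrite ltr_pM2l// mulr_gt0.
  rewrite ltr_pM2r ?(lt_trans p1d)//; apply: (@lt_le_trans _ _ (a2 * b1)).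
    by rewrite ltr_pM2l.
  by rewrite ler_pM2r.
have [e e0 He] := cont_near_pos cW cdd Wd.
have [m [cm md me]] := left_point cd e0.
have : scaled_energy N G r2 p2 m - scaled_energy N G r1 p1 m <=
       scaled_energy N G r2 p2 d - scaled_energy N G r1 p1 d.
  apply: (@mono_ge _ (fun y => scaled_energy N G r2 p2 y - scaled_energy N G r1 p1 y)
   (fun y => - scaled_flux N N (energy G p2 y) (r2 y) (p2 y)
             - - scaled_flux N N (energy G p1 y) (r1 y) (p1 y))).
  - exact: ltW.
  - by apply: (cont_sub (ltW cm) (lexx d)); exact: contB.
  - move=> y /andP[my yd]; have ycd : c < y < d by rewrite (lt_trans cm).
    exact: derB (der_scaled_energy N C2 ycd (dG _ ycd))
                (der_scaled_energy N C1 ycd (dG _ ycd)).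
  - move=> y /andP[my yd]; have ycd : c < y < d by rewrite (lt_trans cm).
    have : 0 < W y.
      apply: He; first by rewrite !ltW//; case/andP: ycd.
      by rewrite ltr0_norm ?subr_lt0//; lra.
    have := cv_p0 C1 ycd; have := cv_p0 C2 ycd; have := G0 y ycd.
    rewrite /W /scaled_flux /energy.
    move: (r1 y ^+ N) (r2 y ^+ N) (r1 y ^+ N.+1) (r2 y ^+ N.+1) => a1 a2 b1 b2.
    move=> g0 p20 p10 w0.
    rewrite (_ : _ - _ = - (2 * N.+1%:R * G y / (p1 y * p2 y)) *
       (a1 * b1 * p2 y - a2 * b2 * p1 y)); last by field; rewrite !gt_eqF.
    rewrite mulr_ge0// ?ltW// oppr_gt0 pmulr_llt0 ?invr_gt0 ?mulr_gt0//.
    by rewrite pmulr_rlt0// mulr_gt0// ltr0n.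
have [|+ _ _] := cmp m; first by rewrite (ltW cm).
by lra.
Qed.

End Two.

Definition momentum N r p x := r x ^+ N.+1 * p x.

Lemma der_momentum N g c d r p x : curve N g c d r p -> c < x < d ->
  is_derive x 1 (momentum N r p) (- (r x ^+ N.+1 * g x / p x)).
Proof.
move=> C xcd; have p0 := cv_p0 C xcd.
have r0 : 0 < r x by apply: (cv_r0 C); case/andP: xcd => /ltW -> /ltW ->.
apply: is_derive_eq (derM (der_rX N C xcd) (cv_derp C xcd)) _.
by rewrite exprS; field; rewrite !gt_eqF.
Qed.

Lemma cont_momentum N g c d r p : curve N g c d r p ->
  {within `[c, d], continuous (momentum N r p)}.
Proof.
by move=> C; apply: contM (cv_contp C); apply: contX (cv_contr C).
Qed.

Lemma momentum_ge0 N g c d r p x : curve N g c d r p -> c <= x <= d ->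
  0 <= momentum N r p x.
Proof.
move=> C xcd; rewrite mulr_ge0 ?(cv_p0' C)//.
by rewrite exprn_ge0// ltW// (cv_r0 C).
Qed.

Lemma momentum_gt0 N g c d r p x : curve N g c d r p -> c <= x <= d ->
  0 < p x -> 0 < momentum N r p x.
Proof. by move=> C xcd px; rewrite mulr_gt0// exprn_gt0// (cv_r0 C). Qed.

(* With k = G / g this is the Erbe-Tang functional. *)
Definition pohozaev N G k r p x :=
  r x ^+ N.+2 * (p x ^+ 2 + 2 * G x) + 2 * N.+2%:R * k x * momentum N r p x.

Lemma cont_pohozaev N g G k c d r p : curve N g c d r p ->
  {within `[c, d], continuous G} -> {within `[c, d], continuous k} ->
  {within `[c, d], continuous (pohozaev N G k r p)}.
Proof.
move=> C cG ck; apply: contD.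
  apply: contM; first exact: contX (cv_contr C).
  apply: contD; first exact: contX (cv_contp C).
  by apply: contM cG; exact: cont_cst.
apply: contM (cont_momentum C); apply: contM ck; exact: cont_cst.
Qed.

Lemma der_pohozaev N g G k c d r p x (dk : R) : curve N g c d r p -> c < x < d ->
  is_derive x 1 G (g x) -> is_derive x 1 k dk -> k x * g x = G x ->
  is_derive x 1 (pohozaev N G k r p)
    (momentum N r p x * (2 * N.+2%:R * dk - N%:R)).
Proof.
move=> C xcd dG hk kg; have p0 := cv_p0 C xcd.
have r0 : 0 < r x by apply: (cv_r0 C); case/andP: xcd => /ltW -> /ltW ->.
apply: is_derive_eq (derD
  (derM (der_rX N.+1 C xcd)
        (derD (derX 2 (cv_derp C xcd)) (derM (derC 2 x) dG)))
  (derM (derM (derC (2 * N.+2%:R) x) hk) (der_momentum C xcd))) _.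
rewrite -kg /momentum /= -[N.+2]addn2 -[N.+1]addn1 !natrD !exprD.
by field; rewrite !gt_eqF.
Qed.

Lemma pohozaev_mono N g G k dk c d r p x y : curve N g c d r p ->
  {within `[c, d], continuous G} -> {within `[c, d], continuous k} ->
  (forall x, c < x < d -> is_derive x 1 G (g x)) ->
  (forall x, c < x < d -> is_derive x 1 k (dk x)) ->
  (forall x, c < x < d -> k x * g x = G x) ->
  (forall x, c < x < d -> 0 <= 2 * N.+2%:R * dk x - N%:R) ->
  c <= x -> x <= y -> y <= d -> pohozaev N G k r p x <= pohozaev N G k r p y.
Proof.
move=> C cG ck dG hk kg dk0 cx xy yd.
have oo z : x < z < y -> c < z < d.
  by move=> /andP[xz zy]; rewrite (le_lt_trans cx)// (lt_le_trans zy).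
apply: (mono_ge xy (df := fun z => momentum N r p z * (2 * N.+2%:R * dk z - N%:R))).
- exact: cont_sub cx yd (cont_pohozaev C cG ck).
- by move=> z /oo zcd; exact: der_pohozaev C zcd (dG _ zcd) (hk _ zcd) (kg _ zcd).
- move=> z /oo zcd; rewrite mulr_ge0 ?dk0// (momentum_ge0 C)//.
  by case/andP: zcd => /ltW -> /ltW.
Qed.

End Phases.

Section Comparison.
Context {R : realType} (N : nat) (g : R -> R) (c d : R) (r1 p1 r2 p2 : R -> R).
Context (cd : c < d).
Context (C1 : curve N g c d r1 p1) (C2 : curve N g c d r2 p2).

Local Notation q1 := (momentum N r1 p1).
Local Notation q2 := (momentum N r2 p2).

Lemma momentum_cmp x : c < x <= d ->
  (forall y, c < y < x -> 0 <= (r1 y ^+ (2 * N.+1) - r2 y ^+ (2 * N.+1)) * g y) ->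
  q1 c < q2 c -> q1 x < q2 x.
Proof.
move=> /andP[cx xd] rg qc.
have : q2 c ^+ 2 - q1 c ^+ 2 <= q2 x ^+ 2 - q1 x ^+ 2.
  apply: (@mono_ge _ (fun y => q2 y ^+ 2 - q1 y ^+ 2) (fun y =>
    2 * (r1 y ^+ (2 * N.+1) - r2 y ^+ (2 * N.+1)) * g y) _ _ (ltW cx)).
  - apply: (cont_sub (lexx c) xd).
    by apply: contB; apply: contX; [exact: cont_momentum C2|exact: cont_momentum C1].
  - move=> y /andP[cy yx]; have ycd : c < y < d by rewrite cy (lt_le_trans yx).
    apply: is_derive_eq (derB (derX 2 (der_momentum C2 ycd))
                              (derX 2 (der_momentum C1 ycd))) _.
    rewrite /= /momentum mulnC !exprM.
    by field; rewrite !gt_eqF ?(cv_p0 C1)// ?(cv_p0 C2).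
  - by move=> y /rg; rewrite -mulrA => ?; rewrite mulr_ge0.
have q10 y : c <= y <= d -> 0 <= q1 y by exact: momentum_ge0 C1.
have q20 y : c <= y <= d -> 0 <= q2 y by exact: momentum_ge0 C2.
have xcd : c <= x <= d by rewrite (ltW cx).
have ccd : c <= c <= d by rewrite lexx (ltW cd).
have : q1 c ^+ 2 < q2 c ^+ 2 by rewrite ltr_pXn2r// nnegrE ?q10 ?q20.
move=> A B; have : q1 x ^+ 2 < q2 x ^+ 2 by lra.
by rewrite ltr_pXn2r// nnegrE ?q10 ?q20.
Qed.

Lemma momentum_speed x : c <= x <= d -> r2 x <= r1 x -> q1 x < q2 x ->
  p1 x < p2 x.
Proof.
move=> xcd r21 q12; rewrite ltNge; apply/negP => p21.
move: q12; rewrite ltNge /momentum => /negP; apply.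
have r20 := cv_r0 C2 xcd; have r10 := cv_r0 C1 xcd.
apply: ler_pM => //; first by rewrite exprn_ge0// ltW.
  exact: (cv_p0' C2).
by apply: lerXn2r => //; rewrite nnegrE ltW.
Qed.

Lemma rising_cmp : (forall x, c < x < d -> 0 <= g x) ->
  r2 c <= r1 c -> q1 c < q2 c ->
  forall x, c <= x <= d -> [/\ q1 x < q2 x, p1 x < p2 x & r2 x <= r1 x].
Proof.
move=> g0 r21 qc.
have step x : c < x <= d -> (forall y, c <= y < x -> p1 y < p2 y) ->
    [/\ q1 x < q2 x, p1 x < p2 x & r2 x <= r1 x].
  move=> /andP[cx xd] h.
  have r21y y : c < y <= x -> r2 y < r1 y.
    move=> /andP[cy yx]; apply: (gap_lt C1 C2) => //; first by rewrite cy (le_trans yx).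
    by move=> z /andP[cz zy]; apply: h; rewrite cz (lt_le_trans zy).
  have r21x : r2 x < r1 x by apply: r21y; rewrite cx lexx.
  have qx : q1 x < q2 x.
    apply: momentum_cmp => //; first by rewrite cx.
    move=> y /andP[cy yx]; have yd := lt_le_trans yx xd.
    rewrite mulr_ge0 ?g0 ?cy// subr_ge0.
    by apply: lerXn2r; rewrite ?nnegrE ltW ?r21y ?cy ?(ltW yx)//
      ?(cv_r0 C1)// ?(cv_r0 C2)// ?(ltW cy) ?(ltW yd).
  split => //; last exact: ltW.
  by apply: momentum_speed => //; [rewrite (ltW cx)|exact: ltW].
have pc : p1 c < p2 c by apply: momentum_speed => //; rewrite lexx ltW.
have cp : {within `[c, d], continuous (fun x => p2 x - p1 x)}.
  by apply: contB; [exact: (cv_contp C2)|exact: (cv_contp C1)].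
suff main x : c <= x <= d -> p1 x < p2 x.
  move=> x /andP[]; rewrite le_eqVlt => /predU1P[<- _|cx xd]; first by split.
  apply: step; rewrite ?cx// => y /andP[cy yx]; apply: main.
  by rewrite cy (le_trans (ltW yx)).
move=> /andP[cx xd]; rewrite ltNge -subr_le0; apply/negP => Dx.
have [|z [/andP[cz zx] Dz zpos]] := first_exit cx (cont_sub (lexx c) xd cp) _ Dx.
  by rewrite subr_gt0.
have [||_ ] := step z; first by rewrite cz (le_trans zx).
  by move=> y /zpos; rewrite subr_gt0.
by lra.
Qed.

Context (G k dk : R -> R).
Context (cG : {within `[c, d], continuous G}) (ck : {within `[c, d], continuous k}).
Context (dG : forall x, c < x < d -> is_derive x 1 G (g x)).
Context (hk : forall x, c < x < d -> is_derive x 1 k (dk x)).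
Context (kg : forall x, c < x < d -> k x * g x = G x).
Context (dk0 : forall x, c < x < d -> 0 <= 2 * N.+2%:R * dk x - N%:R).

Local Notation P1 := (pohozaev N G k r1 p1).
Local Notation P2 := (pohozaev N G k r2 p2).

Lemma pohozaev_cmp x y : c <= x -> x <= y -> y <= d ->
  (forall z, x < z < y -> q1 z <= q2 z) ->
  P2 x - P1 x <= P2 y - P1 y.
Proof.
move=> cx xy yd q12.
apply: (@mono_ge _ (fun z => P2 z - P1 z) (fun z =>
   q2 z * (2 * N.+2%:R * dk z - N%:R) - q1 z * (2 * N.+2%:R * dk z - N%:R)) _ _ xy).
- apply: (cont_sub cx yd).
  by apply: contB; [exact: cont_pohozaev C2 _ _|exact: cont_pohozaev C1 _ _].
- move=> z /andP[xz zy]; have zcd : c < z < d.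
    by rewrite (le_lt_trans cx)// (lt_le_trans zy).
  exact: derB (der_pohozaev C2 zcd (dG zcd) (hk zcd) (kg zcd))
              (der_pohozaev C1 zcd (dG zcd) (hk zcd) (kg zcd)).
- move=> z /andP[xz zy]; have zcd : c < z < d.
    by rewrite (le_lt_trans cx)// (lt_le_trans zy).
  by rewrite -mulrBl mulr_ge0 ?dk0// subr_ge0 q12// xz.
Qed.

Context (g0 : forall x, c < x < d -> g x <= 0).
Context (p1d : 0 < p1 d) (p2d : 0 < p2 d).

Let p1pos x : c < x <= d -> 0 < p1 x.
Proof.
by move=> /andP[cx]; rewrite le_eqVlt => /predU1P[->//|xd]; rewrite (cv_p0 C1)// cx.
Qed.

Let p2pos x : c < x <= d -> 0 < p2 x.
Proof.
by move=> /andP[cx]; rewrite le_eqVlt => /predU1P[->//|xd]; rewrite (cv_p0 C2)// cx.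
Qed.

Let q1pos x : c < x <= d -> 0 < q1 x.
Proof.
move=> h; apply: momentum_gt0 C1 _ (p1pos h).
by move: h => /andP[/ltW -> ->].
Qed.

Let q2pos x : c < x <= d -> 0 < q2 x.
Proof.
move=> h; apply: momentum_gt0 C2 _ (p2pos h).
by move: h => /andP[/ltW -> ->].
Qed.

Let q1inv y x : c < y -> x <= d -> {within `[y, x], continuous (fun z => (q1 z)^-1)}.
Proof.
move=> cy xd; apply: contV.
  exact: cont_sub (ltW cy) xd (cont_momentum C1).
by move=> z /andP[yz zx]; rewrite gt_eqF// q1pos// (lt_le_trans cy)// (le_trans zx).
Qed.

Let der_ratio x : c < x < d -> is_derive x 1 (fun z => q2 z / q1 z)
  (q2 x / q1 x * (g x * ((p1 x ^+ 2)^-1 - (p2 x ^+ 2)^-1))).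
Proof.
move=> xcd; have x' : c < x <= d by case/andP: xcd => -> /ltW.
have q10 : q1 x != 0 by rewrite gt_eqF// q1pos.
apply: is_derive_eq (derM (der_momentum C2 xcd) (derV q10 (der_momentum C1 xcd))) _.
have r1x : r1 x != 0 by rewrite gt_eqF// (cv_r0 C1)//; case/andP: x' => /ltW ->.
rewrite /momentum !exprS; field.
by rewrite expf_neq0 r1x ?gt_eqF ?p1pos// ?p2pos.
Qed.

Let ratio_sign y : c < y < d -> p1 y <= p2 y ->
  q2 y / q1 y * (g y * ((p1 y ^+ 2)^-1 - (p2 y ^+ 2)^-1)) <= 0.
Proof.
move=> ycd p12; have y' : c < y <= d by case/andP: ycd => -> /ltW.
rewrite pmulr_rle0 ?divr_gt0 ?q1pos ?q2pos// mulr_le0_ge0 ?g0//.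
rewrite subr_ge0 lef_pV2 ?posrE ?exprn_gt0 ?p1pos ?p2pos//.
by apply: lerXn2r => //; rewrite nnegrE ltW// ?p1pos ?p2pos.
Qed.

Let ratio y x : c < y -> y <= x -> x <= d ->
  (forall z, y < z < x -> p1 z <= p2 z) -> q2 x / q1 x <= q2 y / q1 y.
Proof.
move=> cy yx xd p12; rewrite -lerN2.
have oo z : y < z < x -> c < z < d.
  by move=> /andP[yz zx]; rewrite (lt_trans cy)// (lt_le_trans zx).
apply: (@mono_ge _ (fun z => - (q2 z / q1 z)) (fun z =>
  - (q2 z / q1 z * (g z * ((p1 z ^+ 2)^-1 - (p2 z ^+ 2)^-1)))) _ _ yx).
- apply: contN; apply: contM (q1inv cy xd).
  exact: cont_sub (ltW cy) xd (cont_momentum C2).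
- by move=> z /oo zcd; exact: derN (der_ratio zcd).
- by move=> z zyx; rewrite oppr_ge0 ratio_sign// ?oo// p12.
Qed.

(* While q1 <= q2 the difference P2 - P1 grows; from the moment q1 = q2 on,
   P2 - P1 * (q2 / q1) takes over, because q2 / q1 decreases as long as
   p1 < p2. *)
Lemma falling_cmp : (forall x, c <= x <= d -> 0 <= G x) ->
  (forall x, c < x <= d -> 0 < P1 x) ->
  r2 c <= r1 c -> q1 c < q2 c -> P1 c < P2 c ->
  forall x, c < x <= d -> [/\ p1 x < p2 x, r2 x < r1 x &
    (q1 x <= q2 x /\ P1 x < P2 x) \/ P1 x * q2 x < P2 x * q1 x].
Proof.
move=> G0 P10 r21 qc Pc.
have alt x : c < x <= d -> (forall y, c <= y < x -> p1 y < p2 y) ->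
    (q1 x <= q2 x /\ P1 x < P2 x) \/ P1 x * q2 x < P2 x * q1 x.
  move=> xcd h; have /andP[cx xd] := xcd.
  have [q12|q21] := leP (q1 x) (q2 x).
    left; split => //.
    have : P2 c - P1 c <= P2 x - P1 x.
      apply: pohozaev_cmp => //; first exact: ltW.
      move=> y /andP[cy yx].
      have ycd : c < y <= d by rewrite cy (le_trans (ltW yx)).
      have := ratio cy (ltW yx) xd; rewrite ler_pdivlMr ?q1pos//.
      move=> H; have {}H : q2 x / q1 x * q1 y <= q2 y.
        by apply: H => z /andP[yz zx]; rewrite ltW// h// (ltW (lt_trans cy yz)).
      apply: le_trans H; rewrite ler_peMl// ?(ltW (q1pos _))//.
      by rewrite ler_pdivlMr ?q1pos// mul1r.
    by lra.
  right.
  have cq : {within `[c, x], continuous (fun z => q2 z - q1 z)}.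
    apply: (cont_sub (lexx c) xd).
    by apply: contB; [exact: cont_momentum C2|exact: cont_momentum C1].
  have [||y [/andP[cy yx] qy ypos]] := first_exit (ltW cx) cq.
  - by rewrite subr_gt0.
  - by rewrite subr_le0 ltW.
  have {}qy : q2 y = q1 y by apply/eqP; rewrite -subr_eq0 qy.
  have ycd : c < y <= d by rewrite cy (le_trans yx).
  have Py : P1 y < P2 y.
    have : P2 c - P1 c <= P2 y - P1 y.
      apply: pohozaev_cmp => //; first exact: ltW.
        exact: le_trans xd.
      by move=> z /andP[cz zy]; rewrite -subr_ge0 ltW// ypos// (ltW cz).
    by lra.
  have oo z : y < z < x -> c < z < d.
    by move=> /andP[yz zx]; rewrite (lt_trans cy)// (lt_le_trans zx).
  have : P2 y - P1 y * (q2 y / q1 y) <= P2 x - P1 x * (q2 x / q1 x).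
    apply: (@mono_ge _ (fun z => P2 z - P1 z * (q2 z / q1 z)) (fun z =>
      - (P1 z * (q2 z / q1 z * (g z * ((p1 z ^+ 2)^-1 - (p2 z ^+ 2)^-1)))))
      _ _ yx).
    - have cyx r p (C : curve N g c d r p) :
          {within `[y, x], continuous (pohozaev N G k r p)}.
        exact: cont_sub (ltW cy) xd (cont_pohozaev C cG ck).
      apply: contB; first exact: cyx.
      apply: contM; first exact: cyx.
      apply: contM (q1inv cy xd).
      exact: cont_sub (ltW cy) xd (cont_momentum C2).
    - move=> z /oo zcd.
      apply: is_derive_eq (derB
        (der_pohozaev C2 zcd (dG zcd) (hk zcd) (kg zcd))
        (derM (der_pohozaev C1 zcd (dG zcd) (hk zcd) (kg zcd))
              (der_ratio zcd))) _.
      have z' : c < z <= d by case/andP: zcd => -> /ltW.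
      move: (q1pos z') (p1pos z') (p2pos z').
      move: (P1 z) (q1 z) (q2 z) => P q q' q0 p10 p20.
      by field; rewrite !gt_eqF.
    - move=> z zyx; have zcd := oo z zyx.
      have z' : c < z <= d by case/andP: zcd => -> /ltW.
      rewrite oppr_ge0 pmulr_rle0 ?P10// ratio_sign// ltW// h//.
      by case/andP: zcd zyx => /ltW -> _ /andP[].
  rewrite qy divff ?gt_eqF ?q1pos// mulr1 => H.
  have : 0 < P2 x - P1 x * (q2 x / q1 x) by lra.
  by rewrite subr_gt0 mulrA ltr_pdivrMr// q1pos.
have pc : p1 c < p2 c by apply: momentum_speed => //; rewrite lexx ltW.
have cp : {within `[c, d], continuous (fun x => p2 x - p1 x)}.
  by apply: contB; [exact: (cv_contp C2)|exact: (cv_contp C1)].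
suff main x : c <= x <= d -> p1 x < p2 x.
  move=> x xcd; have /andP[cx xd] := xcd.
  have h y : c <= y < x -> p1 y < p2 y.
    by move=> /andP[cy yx]; rewrite main// cy (le_trans (ltW yx)).
  by split; [rewrite main// ltW|exact: (gap_lt C1 C2)|exact: alt].
move=> /andP[cx xd]; rewrite ltNge -subr_le0; apply/negP => Dx.
have [|z [/andP[cz zx] Dz zpos]] := first_exit cx (cont_sub (lexx c) xd cp) _ Dx.
  by rewrite subr_gt0.
have zcd : c < z <= d by rewrite cz (le_trans zx).
have h y : c <= y < z -> p1 y < p2 y by move=> /zpos; rewrite subr_gt0.
have p12 : p2 z = p1 z by apply/eqP; rewrite -subr_eq0 Dz.
have zcd' : c <= z <= d by case/andP: zcd => /ltW ->.
have r21z := gap_lt C1 C2 zcd h r21.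
have r20 := cv_r0 C2 zcd'; have r10 := cv_r0 C1 zcd'.
have p10 := p1pos zcd.
have [[+ _]|] := alt z zcd h.
  rewrite /momentum p12 ler_pM2r// ler_pXn2r ?nnegrE ?(ltW r10) ?(ltW r20)//.
  by rewrite leNgt r21z.
rewrite /pohozaev /momentum p12 !exprS.
have a20 : 0 < r2 z ^+ N by rewrite exprn_gt0.
have a10 : 0 < r1 z ^+ N by rewrite exprn_gt0.
have H0 : 0 < p1 z ^+ 2 + 2 * G z by rewrite ltr_wpDr ?exprn_gt0// mulr_ge0// G0.
rewrite -subr_gt0.
rewrite (_ : _ - _ = (r2 z - r1 z) *
   (r1 z * r1 z ^+ N * (r2 z * r2 z ^+ N) * (p1 z ^+ 2 + 2 * G z) * p1 z)); last first.
  by rewrite !expr0; ring.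
rewrite pmulr_lgt0 ?subr_gt0; last by rewrite !mulr_gt0.
by rewrite ltNge ltW.
Qed.

Lemma falling_cmp_end : (forall x, c <= x <= d -> 0 <= G x) ->
  (forall x, c < x <= d -> 0 < P1 x) ->
  r2 c <= r1 c -> q1 c < q2 c -> P1 c < P2 c -> G d = 0 -> k d = 0 ->
  r1 d * p1 d < r2 d * p2 d.
Proof.
move=> G0 P10 r21 qc Pc Gd kd.
have dcd : c < d <= d by rewrite cd lexx.
have [p12 r21d] := falling_cmp G0 P10 r21 qc Pc dcd.
have dcd' : c <= d <= d by rewrite (ltW cd) lexx.
have r20 := cv_r0 C2 dcd'; have r10 := cv_r0 C1 dcd'.
rewrite /pohozaev Gd kd !(mulr0, mul0r, addr0).
have a21 : r2 d ^+ N <= r1 d ^+ N by apply: lerXn2r; rewrite ?nnegrE ltW.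
have a20 : 0 < r2 d ^+ N by rewrite exprn_gt0.
have y1 : 0 < r1 d * p1 d by rewrite mulr_gt0.
have y2 : 0 < r2 d * p2 d by rewrite mulr_gt0.
rewrite /momentum !exprS.
move=> [[_ H]|].
  rewrite -(@ltr_pXn2r _ 2)// ?nnegrE ?(ltW y1) ?(ltW y2)// -(ltr_pM2l a20).
  apply: le_lt_trans (_ : r1 d ^+ N * (r1 d * p1 d) ^+ 2 < _).
    by rewrite ler_wpM2r// exprn_ge0// ltW.
  by rewrite !exprMn; move: H; rewrite !expr0; lra.
have a10 : 0 < r1 d ^+ N by rewrite exprn_gt0.
rewrite -subr_gt0 (_ : _ - _ = (r2 d * p2 d - r1 d * p1 d) *
   (r1 d * p1 d * r1 d ^+ N * (r2 d * p2 d * r2 d ^+ N))); last first.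
  by rewrite !expr0; ring.
by rewrite pmulr_lgt0 ?subr_gt0// !mulr_gt0.
Qed.

End Comparison.

Section Nonlinearity.
Context {R : realType} (f : R -> R).
Implicit Types (s x : R).

Local Notation F := (primitive0 f).
Local Notation K := (fun t => primitive0 f t / f t).

Context (reg : regular_nonlinearity f).

Lemma f_cont x : {within `[0, x], continuous f}.
Proof.
case: reg => + _ _; apply: continuous_subspaceW => y /=.
by rewrite !in_itv/= => /andP[->].
Qed.

Lemma f_der s : 0 < s -> is_derive s 1 f (derive1 f s).
Proof. by case: reg => _ + _ => /[apply] -[+ _]; rewrite derive1E => /derivableP. Qed.

Lemma f_cont_oo s : 0 < s -> {for s, continuous f}.
Proof. by move=> /f_der /der_cont. Qed.

Lemma f_integrable x : lebesgue_measure.-integrable `[0, x] (EFin \o f).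
Proof.
by apply: continuous_compact_integrable (@f_cont x); exact: segment_compact.
Qed.

Lemma F0 : F 0 = 0.
Proof. by rewrite /primitive0 set_itv1 Rintegral_set1. Qed.

Lemma F_cont x : 0 <= x -> {within `[0, x], continuous F}.
Proof. by move=> x0; exact: parameterized_integral_continuous (f_integrable x). Qed.

Lemma F_der s : 0 < s -> is_derive s 1 F (f s).
Proof.
move=> s0; have ss1 : s < s + 1 by rewrite ltrDl.
have [df fE] := continuous_FTC1_closed ss1 (f_integrable (s + 1)) s0 (f_cont_oo s0).
by rewrite -fE derive1E; exact/derivableP.
Qed.

Lemma F_mono x y : 0 <= x -> x <= y -> (forall s, x < s < y -> 0 <= f s) -> F x <= F y.
Proof.
move=> x0 xy h; apply: (mono_ge xy _ _ h).
  exact: cont_sub x0 (lexx y) (F_cont (le_trans x0 xy)).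
by move=> s /andP[xs _]; apply: F_der; exact: le_lt_trans xs.
Qed.

Lemma F_mono_lt x y : 0 <= x -> x < y -> (forall s, x < s < y -> 0 < f s) -> F x < F y.
Proof.
move=> x0 xy h; apply: (mono_gt xy _ _ h).
  exact: cont_sub x0 (lexx y) (F_cont (le_trans x0 (ltW xy))).
by move=> s /andP[xs _]; apply: F_der; exact: le_lt_trans xs.
Qed.

Lemma F_anti x y : 0 <= x -> x <= y -> (forall s, x < s < y -> f s <= 0) -> F y <= F x.
Proof.
move=> x0 xy h; rewrite -lerN2.
apply: (@mono_ge _ (fun z => - F z) (fun z => - f z) _ _ xy).
- by apply: contN; exact: cont_sub x0 (lexx y) (F_cont (le_trans x0 xy)).
- by move=> s /andP[xs _]; apply: derN; apply: F_der; exact: le_lt_trans xs.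
- by move=> s /h; rewrite oppr_ge0.
Qed.

Lemma F_anti_lt x y : 0 <= x -> x < y -> (forall s, x < s < y -> f s < 0) -> F y < F x.
Proof.
move=> x0 xy h; rewrite -ltrN2.
apply: (@mono_gt _ (fun z => - F z) (fun z => - f z) _ _ xy).
- by apply: contN; exact: cont_sub x0 (lexx y) (F_cont (le_trans x0 (ltW xy))).
- by move=> s /andP[xs _]; apply: derN; apply: F_der; exact: le_lt_trans xs.
- by move=> s /h; rewrite oppr_gt0.
Qed.

Context (B beta : R) (sgn : sign_condition f B beta).

Lemma sign_order : [/\ 0 <= B, B <= beta & forall s, B < s -> 0 < f s].
Proof.
case: sgn => _ [[/andP[? ?] ? _ _ _]|[-> -> h]]; first by split => //; exact: ltW.
by split.
Qed.

Lemma f0 : f 0 = 0. Proof. by case: sgn. Qed.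

Lemma sign_B0 : B = 0 -> beta = 0.
Proof. by case: sgn => _ [[/andP[+ _] _ _ _ _]|[-> _ _]]//; move=> /[swap] ->; rewrite ltxx. Qed.

Lemma sign_B0lt : 0 < B -> B < beta.
Proof. by case: sgn => _ [[/andP[_ ->] _ _ _ _]|[_ -> _]]//; rewrite ltxx. Qed.

Lemma F_beta : F beta = 0.
Proof. by case: sgn => _ [[]|[-> _ _]]//; rewrite F0. Qed.

Lemma F_gt0 s : beta < s -> 0 < F s.
Proof.
have [B0 Bb fB] := sign_order.
move=> bs; rewrite -F_beta; apply: F_mono_lt => //; first exact: le_trans Bb.
by move=> t /andP[bt _]; apply: fB; exact: le_lt_trans bt.
Qed.

Lemma F_lt0 s : 0 < s < beta -> F s < 0.
Proof.
move=> /andP[s0 sb]; have [B0 Bb fB] := sign_order.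
have fs0 : 0 < beta by exact: lt_trans sb.
case: sgn => _ [[/andP[B0' Bb'] _ fneg [e e0 he] Fb]|[b0 _ _]]; last first.
  by rewrite b0 ltxx in fs0.
have [sB|Bs] := leP s B; last first.
  rewrite -Fb; apply: F_mono_lt => //; first exact: ltW.
  by move=> t /andP[st _]; apply: fB; exact: lt_trans st.
pose t := Num.min s e.
have t0 : 0 < t by rewrite lt_min s0.
have ts : t <= s by rewrite ge_min lexx.
have te : t <= e by rewrite ge_min lexx orbT.
apply: (@le_lt_trans _ _ (F t)).
  apply: F_anti => //; first exact: ltW.
  move=> x /andP[tx xs]; apply: fneg.
  by rewrite (ltW (lt_trans t0 tx)) (le_trans (ltW xs)).
rewrite -F0; apply: F_anti_lt => // x /andP[x0 xt].
by apply: he; rewrite x0 (lt_le_trans xt).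
Qed.

Lemma F_le0 s : 0 <= s <= beta -> F s <= 0.
Proof.
move=> /andP[]; rewrite le_eqVlt => /predU1P[<-|s0]; first by rewrite F0.
rewrite le_eqVlt => /predU1P[->|sb]; first by rewrite F_beta.
by rewrite ltW// F_lt0// s0.
Qed.

Lemma K_beta : K beta = 0. Proof. by rewrite /= F_beta mul0r. Qed.

Lemma K_derivable s : 0 < s -> B < s -> is_derive s 1 K (derive1 K s).
Proof.
move=> s0 Bs; have [_ _ fB] := sign_order.
have fs : f s != 0 by rewrite gt_eqF// fB.
rewrite derive1E; apply: derivableP.
exact: (@ex_derive _ _ _ _ _ _ _ (derM (F_der s0) (derV fs (f_der s0)))).
Qed.

Context (N : nat) (sub : subcritical N.+2 f beta) (sup : superlinear f B beta).

Lemma K_speed s : beta < s -> 0 <= 2 * N.+2%:R * derive1 K s - N%:R.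
Proof.
move=> /sub; rewrite -addn2 natrD addrK ler_pdivrMr; last first.
  by rewrite mulr_gt0// ltr_wpDl.
by lra.
Qed.

Lemma quot_der s : B < s ->
  is_derive s 1 (fun t => f t / (t - B)) ((derive1 f s * (s - B) - f s) / (s - B) ^+ 2).
Proof.
move=> Bs; have [B0 _ _] := sign_order.
have s0 : 0 < s by exact: le_lt_trans Bs.
have sB : s - B != 0 by rewrite subr_eq0 gt_eqF.
apply: is_derive_eq (derM (f_der s0)
  (derV (f := fun t => t - B) sB (derB (derI s) (derC B s)))) _.
by field.
Qed.

Lemma quot_mono x y : B < x -> x <= y -> f x / (x - B) <= f y / (y - B).
Proof.
move=> Bx xy; apply: (@mono_ge _ (fun t => f t / (t - B))
  (fun s => (derive1 f s * (s - B) - f s) / (s - B) ^+ 2) _ _ xy).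
- apply: der_cont_on => s /andP[xs _]; apply: quot_der; exact: lt_le_trans xs.
- by move=> s /andP[xs _]; apply: quot_der; exact: lt_trans xs.
- move=> s /andP[xs _]; have Bs := lt_trans Bx xs.
  rewrite divr_ge0 ?exprn_ge0 ?subr_ge0 ?(ltW Bs)//.
  by case: sup => + _; apply.
Qed.

Lemma quot_rigid x s y : B < x -> x < s < y ->
  f y * (x - B) = f x * (y - B) -> f s = derive1 f s * (s - B).
Proof.
move=> Bx /andP[xs sy] fxy; have Bs := lt_trans Bx xs; have By := lt_trans Bs sy.
have [xB sB yB] : [/\ 0 < x - B, 0 < s - B & 0 < y - B] by rewrite !subr_gt0.
apply/eqP; rewrite eq_le; apply/andP; split; first by case: sup => + _; apply.
rewrite -subr_le0 leNgt; apply/negP => h.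
have dpos : 0 < (derive1 f s * (s - B) - f s) / (s - B) ^+ 2.
  by rewrite divr_gt0// exprn_gt0.
have [e e0 [H _]] := der_pos_near (quot_der Bs) dpos.
have [z [sz ze /ltW zy]] := right_point sy e0.
have := H z; rewrite sz ze => /(_ isT).
have := quot_mono Bx (ltW xs); have := quot_mono (lt_trans Bs sz) zy.
have -> : f y / (y - B) = f x / (x - B).
  by apply/eqP; rewrite eqr_div ?(gt_eqF xB) ?(gt_eqF yB)// fxy.
by lra.
Qed.

Lemma K_le s : B = 0 -> 0 < s -> 0 <= K s <= s.
Proof.
move=> Be s0; have [_ _ fB] := sign_order; rewrite Be in fB.
have Fs : 0 <= F s.
  by rewrite -F0; apply: F_mono => //; [exact: ltW|move=> t /andP[t0 _]; rewrite ltW// fB].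
rewrite divr_ge0 ?(ltW (fB _ _))//= ler_pdivrMr ?fB//.
have : s * f s - 0 * f 0 - (F s - F 0) >= 0; last by rewrite F0; lra.
have cF := F_cont (ltW s0).
suff : 0 * f s - F 0 <= s * f s - F s by rewrite F0; lra.
apply: (@mono_ge _ (fun t => t * f s - F t) (fun t => f s - f t) _ _ (ltW s0)).
- by apply: contB cF; apply: contM; [exact: cont_id|exact: cont_cst].
- move=> t /andP[t0 _].
  by apply: is_derive_eq (derB (derM (derI t) (derC (f s) t)) (F_der t0)) _; ring.
- move=> t /andP[t0 ts]; rewrite subr_ge0.
  have Bt : B < t by rewrite Be.
  have := quot_mono Bt (ltW ts); rewrite Be !subr0 ler_pdivrMr//.
  move/le_trans; apply; rewrite -mulrA ler_piMr ?(ltW (fB _ _))//.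
  by rewrite mulrC ler_pdivrMr// mul1r ltW.
Qed.

(* For B = beta = 0 the junk value F 0 / f 0 = 0 / 0 = 0 is the limit of F / f
   at 0, by K_le. *)
Lemma K_cont x : beta <= x -> {within `[beta, x], continuous K}.
Proof.
have [B0 Bb fB] := sign_order.
move: B0; rewrite le_eqVlt => /predU1P[B0|B0]; last first.
  move=> _; apply: (der_cont_on (df := derive1 K)) => s /andP[bs _].
  by apply: K_derivable; [exact: lt_le_trans (lt_le_trans B0 Bb) bs|
                          exact: lt_le_trans (sign_B0lt B0) bs].
have b0 := sign_B0 (esym B0); rewrite b0 le_eqVlt => /predU1P[<-|x0].
  by rewrite set_itv1; exact: continuous_subspace1.
apply/(continuous_within_itvP _ x0); split.
- move=> s; rewrite in_itv/= => /andP[s0 _].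
  by apply: (@der_cont _ _ _ (derive1 K s)); apply: K_derivable; rewrite -?B0.
- rewrite f0 invr0 mulr0.
  apply: (@squeeze_cvgr _ _ _ _ (fun=> 0) (fun t => t)).
  + near=> t; apply: K_le => //; near: t; exact: nbhs_right_gt.
  + exact: cvg_cst.
  + exact: cvg_at_right_filter.
- apply: cvg_at_left_filter.
  have Bx : B < x by rewrite -B0.
  exact: (der_cont (K_derivable x0 Bx)).
Unshelve. all: by end_near. Qed.

End Nonlinearity.

Section Solutions.
Context {R : realType}.
Implicit Types (f u du : R -> R) (a b r : R) (N : nat).

Record sol N f a b u du : Prop := Sol {
  sol_cu : {within `[a, b], continuous u};
  sol_cdu : {within `[a, b], continuous du};
  sol_u : forall r, a < r < b -> is_derive r 1 u (du r);
  sol_du : forall r, a < r < b ->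
    is_derive r 1 du (- (N.+1%:R / r * du r) - f (u r));
  sol_a : u a = 0;
  sol_b : u b = 0;
  sol_pos : forall r, a < r < b -> 0 < u r }.

Lemma quotient_cvg_eq a b u (r l l' : R) : a < r < b ->
  (u x - u r) / (x - r) @[x --> within `[a, b] r^'] --> l ->
  is_derive r 1 u l' -> l = l'.
Proof.
move=> /andP[ar rb] hl [hd hl'].
have {hl'}hd : (fun h => h^-1 *: (u (h *: 1 + r) - u r)) @ 0^' --> l'.
  by rewrite -hl'; exact: hd.
apply/eqP; rewrite -subr_eq0 -normr_le0 leNgt; apply/negP => l0.
have e0 : 0 < `|l - l'| / 2 by lra.
move/cvgrPdist_lt : hl => /(_ _ e0); move/cvgrPdist_lt : hd => /(_ _ e0).
rewrite /prop_near1 /nbhs/= /dnbhs/= /within/=.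
move=> -[d1 /= d10 H1] [d2 /= d20 H2].
pose h := Num.min (Num.min d1 d2) (b - r) / 2.
have hm : 0 < Num.min (Num.min d1 d2) (b - r) by rewrite !lt_min d10 d20 subr_gt0.
have h0 : 0 < h by rewrite divr_gt0.
have [hd1 hd2 hb] : [/\ h < d1, h < d2 & h < b - r].
  have : h < Num.min (Num.min d1 d2) (b - r) by rewrite /h; lra.
  by rewrite !lt_min => /andP[/andP[]].
have := H1 h; rewrite /ball_/= sub0r normrN gtr0_norm// => /(_ hd1).
rewrite gt_eqF// => /(_ isT); rewrite /GRing.scale/= mulr1.
have := H2 (h + r); rewrite /ball_/= opprD addrCA subrr addr0 normrN gtr0_norm//.
move=> /(_ hd2); rewrite -subr_eq0 addrK gt_eqF// => /(_ isT).
rewrite in_itv/= => /(_ _)/wrap[]; first by apply/andP; split; lra.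
rewrite mulrC; move: (h^-1 * _) => q.
move=> A A'; have : `|l - l'| <= `|l - q| + `|l' - q|.
  by rewrite [`|l' - q|]distrC; exact: ler_distD.
by lra.
Qed.

Lemma quotient_cvg_continuous a b u du :
  (forall r, a <= r <= b ->
     (u x - u r) / (x - r) @[x --> within `[a, b] r^'] --> du r) ->
  {within `[a, b], continuous u}.
Proof.
move=> hq; apply/subspace_continuousP => r; rewrite /= in_itv/= => rab.
apply/cvgrPdist_lt => e e0.
move/cvgrPdist_lt : (hq r rab) => /(_ 1 ltr01).
rewrite /prop_near1 /nbhs/= /dnbhs/= /within/= => -[d d0 H].
have m0 : 0 < `|du r| + 1 by rewrite ltr_wpDl.
exists (Num.min d (e / (`|du r| + 1))) => /=; first by rewrite lt_min d0 divr_gt0.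
move=> x; rewrite /ball_/= lt_min => /andP[xd xe] xab.
have [->|xr] := eqVneq x r; first by rewrite subrr normr0.
have := H x xd xr xab.
have xr0 : x - r != 0 by rewrite subr_eq0.
set q := _ / _ => qd.
have -> : u r - u x = q * (r - x) by rewrite /q; field.
rewrite normrM; have {qd}qm : `|q| < `|du r| + 1.
  have := ler_distD (du r) q 0; rewrite !subr0 => /le_lt_trans; apply.
  by rewrite addrC ltrD2l distrC.
have : `|q| * `|r - x| <= (`|du r| + 1) * `|r - x| by rewrite ler_wpM2r// ltW.
move=> /le_lt_trans; apply.
by rewrite mulrC -ltr_pdivlMr.
Qed.

Lemma positive_solution_sol N f a b u : positive_solution N.+2 f a b u ->
  exists du, sol N f a b u du.
Proof.
move=> [[C2 [du cdu hdu]] ode [ua ub] up].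
have u'E r : a < r < b -> is_derive r 1 u (du r).
  move=> rab; have [d1 _ _] := C2 r rab.
  have h := derivableP d1.
  rewrite (@quotient_cvg_eq a b u r (du r) _ rab _ h)//.
  by apply: hdu; case/andP: rab => /ltW -> /ltW ->.
exists du; split => //.
- exact: quotient_cvg_continuous hdu.
- move=> r rab; have [_ d2 _] := C2 r rab.
  have h2 := derivableP d2.
  have := ode r rab; rewrite (derive1E (derive1 u)) => odr.
  have u'r y : a < y < b -> derive1 u y = du y.
    by move=> /u'E h; rewrite derive1E; exact: derive_val.
  have D2E : 'D_1 (derive1 u) r = - (N.+1%:R / r * du r) - f (u r).
    by move: odr; rewrite (u'r r rab) -natr1; lra.
  rewrite -D2E; apply: near_eq_is_derive h2.
  have : \forall y \near r, y \in `]a, b[ by apply: near_in_itvoo; rewrite in_itv.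
  by apply: filterS => y; rewrite in_itv/= => /u'r.
Qed.

End Solutions.

Section Shape.
Context {R : realType} (f : R -> R) (B beta : R).
Context (reg : regular_nonlinearity f) (sgn : sign_condition f B beta).
Context (N : nat) (a b : R) (u du : R -> R).
Context (a0 : 0 < a) (ab : a < b) (S : sol N f a b u du).
Implicit Types r x y : R.

Local Notation F := (primitive0 f).

Lemma sol_ge0 r : a <= r <= b -> 0 <= u r.
Proof.
move=> /andP[]; rewrite le_eqVlt => /predU1P[<-|ar]; first by rewrite (sol_a S).
rewrite le_eqVlt => /predU1P[->|rb]; first by rewrite (sol_b S).
by rewrite ltW// (sol_pos S)// ar.
Qed.

Lemma sol_F_cont : {within `[a, b], continuous (fun r => F (u r))}.
Proof.
have [c _ hc] := EVT_max (ltW ab) (sol_cu S).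
have c0 : 0 <= u c.
  by apply: le_trans (hc a _); rewrite ?(sol_a S)// in_itv/= lexx ltW.
apply: (cont_comp (F_cont reg c0) (sol_cu S)) => r rab.
by rewrite sol_ge0//= hc// in_itv.
Qed.

Let E r := du r ^+ 2 / 2 + F (u r).

Let E_cont : {within `[a, b], continuous E}.
Proof.
apply: contD sol_F_cont; apply: contM; last exact: cont_cst.
exact: (contX (k := 2) (sol_cdu S)).
Qed.

Let E_der r : a < r < b -> is_derive r 1 E (- (N.+1%:R / r * du r ^+ 2)).
Proof.
move=> rab; have ur := sol_pos S rab.
have r0 : r != 0 by rewrite gt_eqF// (lt_trans a0)//; case/andP: rab.
apply: is_derive_eq (derD (derM (derX 2 (sol_du S rab)) (derC 2^-1 r))
  (der_comp (F_der reg ur) (sol_u S rab))) _.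
by rewrite /=; field.
Qed.

Let E_mono x y : a <= x -> x <= y -> y <= b -> E y <= E x.
Proof.
move=> ax xy yb; rewrite -lerN2.
apply: (@mono_ge _ (fun z => - E z) (fun z => - - (N.+1%:R / z * du z ^+ 2)) _ _ xy).
- exact: contN (cont_sub ax yb E_cont).
- move=> z /andP[xz zy]; apply/derN/E_der.
  by rewrite (le_lt_trans ax)// (lt_le_trans zy).
- move=> z /andP[xz zy]; rewrite opprK mulr_ge0 ?exprn_even_ge0// divr_ge0//.
  by rewrite ltW// (lt_trans a0)// (le_lt_trans ax).
Qed.

Lemma sol_energy_ge0 r : a <= r <= b -> 0 <= du r ^+ 2 / 2 + F (u r).
Proof.
move=> /andP[ar rb]; apply: le_trans (E_mono ar rb (lexx b)).
by rewrite /E (sol_b S) F0 addr0 divr_ge0// exprn_even_ge0.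
Qed.

Lemma sol_energy_gt0 r : a <= r < b -> 0 < du r ^+ 2 / 2 + F (u r).
Proof.
move=> /andP[ar rb].
pose r' := (r + b) / 2.
have [rr' r'b] : r < r' /\ r' < b by rewrite /r'; split; lra.
have r'ab : a < r' < b by rewrite r'b (le_lt_trans ar).
have [z] : exists2 z, z \in `]r', b[ & u b - u r' = du z * (b - r').
  apply: MVT => //; last by apply: cont_sub (sol_cu S) => //; rewrite ltW//; case/andP: r'ab.
  move=> z; rewrite in_itv/= => /andP[z1 z2]; apply: (sol_u S).
  by rewrite z2 andbT (lt_trans _ z1)//; case/andP: r'ab.
rewrite in_itv/= (sol_b S) => /andP[r'z zb] uE.
have az : a < z by rewrite (lt_trans _ r'z)//; case/andP: r'ab.
have zab : a < z < b by rewrite az.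
have duz : du z != 0.
  apply/eqP => dz; have := sol_pos S r'ab.
  by move: uE; rewrite dz mul0r sub0r => /eqP; rewrite oppr_eq0 => /eqP ->; rewrite ltxx.
have z0 := lt_trans a0 az.
have dE : 0 < - - (N.+1%:R / z * du z ^+ 2).
  by rewrite opprK mulr_gt0 ?divr_gt0 ?exprn_even_gt0.
have [e e0 [He _]] := der_pos_near (derN (E_der zab)) dE.
have [y [zy ye yb]] := right_point zb e0.
have := He y; rewrite zy ye => /(_ isT); rewrite ltrN2 => Ezy.
have Ey : 0 <= E y.
  by apply: sol_energy_ge0; rewrite ltW ?(ltW yb)// (lt_trans az).
have Er : E z <= E r by apply: E_mono => //; rewrite ltW// (lt_trans rr').
exact: le_lt_trans Ey (lt_le_trans Ezy Er).
Qed.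

Lemma sol_critical r : a < r < b -> du r = 0 -> beta < u r /\ 0 < f (u r).
Proof.
move=> /[dup] rab /andP[ar rb] dr.
have := @sol_energy_gt0 r; rewrite (ltW ar) rb dr expr0n mul0r add0r => /(_ isT) Fu.
have [B0 Bb fB] := sign_order sgn.
have bu : beta < u r.
  rewrite ltNge; apply/negP => ub.
  have : F (u r) <= 0 by apply: F_le0 sgn _ _ => //; rewrite sol_ge0// !ltW.
  by rewrite leNgt Fu.
by split => //; apply: fB; exact: le_lt_trans bu.
Qed.

Lemma sol_shape : exists m, [/\ a < m < b /\ du m = 0, beta < u m,
  forall r, a <= r < m -> 0 < du r, forall r, m < r < b -> du r < 0 & du b <= 0].
Proof.
have crit r : a < r < b -> du r = 0 ->
    exists2 e, 0 < e & (forall y, r < y < r + e -> du y < 0) /\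
                       (forall y, r - e < y < r -> 0 < du y).
  move=> rab dr; have [_ fu] := sol_critical rab dr.
  have pos : 0 < - (- (N.+1%:R / r * du r) - f (u r)) by rewrite dr mulr0; lra.
  have [e e0 [H1 H2]] := der_pos_near (derN (sol_du S rab)) pos.
  exists e => //; split.
    by move=> y /H1; rewrite dr oppr0 oppr_gt0.
  by move=> y /H2; rewrite dr oppr0 oppr_lt0.
have cdu x y : a <= x -> y <= b -> {within `[x, y], continuous du}.
  by move=> ax yb; exact: cont_sub ax yb (sol_cdu S).
have neg x y : a < x -> x <= y -> y < b -> du x < 0 -> du y < 0.
  move=> ax xy yb dx; rewrite ltNge; apply/negP => dy.
  have [||z [/andP[xz zy] dz zneg]] := first_exit xy (contN (cdu x y (ltW ax) (ltW yb))).
  - by rewrite oppr_gt0.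
  - by rewrite oppr_le0.
  have zab : a < z < b by rewrite (lt_trans ax)// (le_lt_trans zy).
  have dz0 : du z = 0 by apply/eqP; rewrite -oppr_eq0 dz.
  have [e e0 [_ H]] := crit z zab dz0.
  have [p [xp pz pe]] := left_point xz e0.
  have := zneg p; rewrite (ltW xp) pz oppr_gt0 => /(_ isT).
  by have := H p; rewrite pe pz => /(_ isT); lra.
have [m mab hm] := EVT_max (ltW ab) (sol_cu S).
have um : 0 < u m.
  pose r := (a + b) / 2; have rab : a < r < b.
    by rewrite /r; apply/andP; move: ab => ab'; split; lra.
  apply: lt_le_trans (sol_pos S rab) (hm r _).
  by rewrite in_itv/=; case/andP: rab => /ltW -> /ltW.
have {}mab : a < m < b.
  move: mab; rewrite in_itv/= => /andP[am mb].
  rewrite !lt_neqAle am mb !andbT; apply/andP; split; apply/eqP => mE.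
    by rewrite -mE (sol_a S) ltxx in um.
  by rewrite mE (sol_b S) ltxx in um.
have /andP[am mb] := mab.
have dm : du m = 0.
  have h : is_derive m 1 u 0.
    apply: (@derive1_at_max _ u a b m (ltW ab)).
    - by move=> t; rewrite in_itv/= => /(sol_u S) ?; exact: ex_derive.
    - by rewrite in_itv.
    - by move=> t; rewrite in_itv/= => /andP[? ?]; apply: hm; rewrite in_itv/= !ltW.
  by rewrite -(@derive_val _ _ _ _ _ _ _ (sol_u S mab)) (@derive_val _ _ _ _ _ _ _ h).
have [bm _] := sol_critical mab dm.
have [e e0 [Hr Hl]] := crit m mab dm.
have dneg r : m < r < b -> du r < 0.
  move=> /andP[mr rb].
  have [y [my ye /ltW yr]] := right_point mr e0.
  by apply: neg (yr) rb _; [exact: lt_trans my|apply: Hr; rewrite my].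
exists m; split => //.
- have da : 0 < du a.
    have := @sol_energy_gt0 a; rewrite lexx ab (sol_a S) F0 addr0 => /(_ isT).
    rewrite pmulr_lgt0 ?invr_gt0// exprn_even_gt0//= => da0.
    rewrite lt_neqAle eq_sym da0/= leNgt; apply/negP => da.
    have Nda : 0 < - du a by rewrite oppr_gt0.
    have aab : a <= a <= b by rewrite lexx ltW.
    have [d d0 H] := cont_near_pos (contN (sol_cdu S)) aab Nda.
    have [x [ax xd xb]] := right_point ab d0.
    have : - u a < - u x.
      apply: (@mono_gt _ (fun y => - u y) (fun y => - du y) _ _ ax).
      - exact: contN (cont_sub (lexx a) (ltW xb) (sol_cu S)).
      - by move=> y /andP[ay yx]; apply/derN/(sol_u S); rewrite ay (lt_trans yx).
      - move=> y /andP[ay yx]; apply: H; first by rewrite !ltW// (lt_trans yx).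
        by rewrite gtr0_norm ?subr_gt0//; lra.
    rewrite (sol_a S) ltrN2 ltNge => /negP; apply; apply: sol_ge0.
    by rewrite !ltW.
  move=> r /andP[ar rm]; rewrite ltNge; apply/negP => dr.
  have [|z [/andP[az zr] dz zpos]] := first_exit ar (cdu a r (lexx a) (ltW (lt_trans rm mb))) da.
    by [].
  have zm := le_lt_trans zr rm.
  have zab : a < z < b by rewrite az (lt_trans zm).
  have [d d0 [H _]] := crit z zab dz.
  have [x [zx xd /ltW xm]] := right_point zm d0.
  have := neg x m (lt_trans az zx) xm mb; rewrite dm ltxx => H'.
  by have := H' (H x _); rewrite zx xd => /(_ isT).
- rewrite -oppr_ge0; apply: (cont_left_ge0 (D := fun y => - du y) mb).
    exact: contN (cdu m b (ltW am) (lexx b)).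
  by move=> y /dneg; rewrite oppr_ge0 => /ltW.
Qed.

End Shape.

Section Inverse.
Context {R : realType}.
Implicit Types (x r s : R).

Lemma inverse_curve (N : nat) (g w dw : R -> R) (c d : R) : 0 < c -> c < d ->
  {within `[c, d], continuous w} -> {within `[c, d], continuous dw} ->
  (forall r, c < r < d -> is_derive r 1 w (dw r)) ->
  (forall r, c < r < d -> is_derive r 1 dw (- (N.+1%:R / r * dw r) - g (w r))) ->
  (forall r, c < r < d -> 0 < dw r) -> (forall r, c <= r <= d -> 0 <= dw r) ->
  exists rho : R -> R, [/\ curve N g (w c) (w d) rho (fun x => dw (rho x)),
    forall x, w c <= x <= w d -> c <= rho x <= d /\ w (rho x) = x,
    forall r, c <= r <= d -> rho (w r) = r & w c < w d].
Proof.
move=> c0 cd cw cdw hw hdw dw0 dw0'.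
have inc x y : c <= x -> x < y -> y <= d -> w x < w y.
  move=> cx xy yd; apply: (mono_gt xy (cont_sub cx yd cw) (df := dw)).
    by move=> z /andP[xz zy]; apply: hw; rewrite (le_lt_trans cx)// (lt_le_trans zy).
  by move=> z /andP[xz zy]; apply: dw0; rewrite (le_lt_trans cx)// (lt_le_trans zy).
have wcd : w c < w d by exact: inc.
pose rho x := xget c [set r | c <= r <= d /\ w r = x].
have rhoP x : w c <= x <= w d -> c <= rho x <= d /\ w (rho x) = x.
  move=> xw.
  have [r] : exists2 r, r \in `[c, d] & w r = x.
    apply: IVT => //; first exact: ltW.
    by rewrite (min_idPl (ltW wcd)) (max_idPr (ltW wcd)).
  rewrite in_itv/= => rcd wr.
  by rewrite /rho; case: xgetP => [y _ //|/(_ r)] H; exfalso; apply: H.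
have rhoK r : c <= r <= d -> rho (w r) = r.
  move=> /andP[cr rd].
  have /rhoP[/andP[c1 d1] E] : w c <= w r <= w d.
    move: cr rd; rewrite !le_eqVlt => /predU1P[<-|cr] /predU1P[->|rd];
      by rewrite ?eqxx ?ltxx ?inc ?orbT// ltW.
  have [lt|gt|//] := ltgtP (rho (w r)) r.
    by have := inc _ _ c1 lt rd; rewrite E ltxx.
  by have := inc _ _ cr gt d1; rewrite E ltxx.
have crho : {within `[w c, w d], continuous rho}.
  apply: segment_can_le_continuous cw _; first exact: ltW.
  by move=> r; rewrite in_itv/=; exact: rhoK.
have oo x : w c < x < w d -> c < rho x < d /\ w (rho x) = x.
  move=> /andP[cx xd].
  have [/andP[c1 d1] E] : c <= rho x <= d /\ w (rho x) = x by apply: rhoP; rewrite !ltW.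
  split => //; rewrite !lt_neqAle c1 d1 !andbT; apply/andP; split; apply/eqP => H.
    by move: cx; rewrite -E -H ltxx.
  by move: xd; rewrite -E H ltxx.
have drho x : w c < x < w d -> is_derive x 1 rho (dw (rho x))^-1.
  move=> /oo[rcd E]; rewrite -{1}E.
  have nr : \forall y \near rho x, y \in `]c, d[ by apply: near_in_itvoo; rewrite in_itv.
  apply: is_derive_inverse (hw _ rcd) _; last by rewrite gt_eqF// dw0.
    by apply: filterS nr => y; rewrite in_itv/= => /andP[? ?]; apply: rhoK; rewrite !ltW.
  by apply: filterS nr => y; rewrite in_itv/= => /hw /der_cont.
exists rho; split => //; split => //.
- by apply: (cont_comp cdw crho) => x /rhoP[].
- move=> x xw; have [rcd E] := oo x xw.
  have r0 : 0 < rho x by rewrite (lt_trans c0)//; case/andP: rcd.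
  apply: is_derive_eq (der_comp (hdw _ rcd) (drho x xw)) _.
  by rewrite E; field; rewrite !gt_eqF// dw0.
- by move=> x /rhoP[/andP[+ _] _]; exact: lt_le_trans.
- by move=> x /oo[/dw0].
- by move=> x /rhoP[/dw0'].
Qed.

Context (f : R -> R) (N : nat) (a b m : R) (u du : R -> R).
Context (a0 : 0 < a) (S : sol N f a b u du) (mab : a < m < b) (dm : du m = 0).

Lemma rising_branch : (forall r, a <= r < m -> 0 < du r) ->
  exists rho : R -> R, [/\ curve N f 0 (u m) rho (fun x => du (rho x)),
    forall x, 0 <= x <= u m -> a <= rho x <= m /\ u (rho x) = x &
    forall r, a <= r <= m -> rho (u r) = r].
Proof.
move=> dpos; have /andP[am mb] := mab.
have oo r : a < r < m -> a < r < b by move=> /andP[-> /lt_trans]; apply.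
have [] := @inverse_curve N f u du a m a0 am.
- exact: cont_sub (lexx a) (ltW mb) (sol_cu S).
- exact: cont_sub (lexx a) (ltW mb) (sol_cdu S).
- by move=> r /oo /(sol_u S).
- by move=> r /oo /(sol_du S).
- by move=> r /andP[/ltW ar rm]; rewrite dpos// ar.
- move=> r /andP[ar]; rewrite le_eqVlt => /predU1P[->|rm]; first by rewrite dm.
  by rewrite ltW// dpos// ar.
by rewrite (sol_a S) => rho [? ? ? _]; exists rho.
Qed.

Lemma falling_branch : (forall r, m < r < b -> du r < 0) -> du b <= 0 ->
  exists rho : R -> R,
   [/\ curve N (fun x => - f (- x)) (- u m) 0 rho (fun x => - du (rho x)),
    forall x, - u m <= x <= 0 -> m <= rho x <= b /\ u (rho x) = - x &
    forall r, m <= r <= b -> rho (- u r) = r].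
Proof.
move=> dneg db; have /andP[am mb] := mab.
have oo r : m < r < b -> a < r < b by move=> /andP[/(lt_trans am) -> ->].
have [] := @inverse_curve N (fun x => - f (- x)) (fun r => - u r) (fun r => - du r)
  m b (lt_trans a0 am) mb.
- exact: contN (cont_sub (ltW am) (lexx b) (sol_cu S)).
- exact: contN (cont_sub (ltW am) (lexx b) (sol_cdu S)).
- by move=> r /oo /(sol_u S) /derN.
- move=> r /oo /(sol_du S) /derN h; apply: is_derive_eq h _.
  by rewrite (opprK (u r)); ring.
- by move=> r /dneg; rewrite oppr_gt0.
- move=> r /andP[]; rewrite le_eqVlt => /predU1P[<-|mr]; first by rewrite dm oppr0.
  rewrite le_eqVlt => /predU1P[->|rb]; first by rewrite oppr_ge0.
  by rewrite oppr_ge0 ltW// dneg// mr.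
rewrite (sol_b S) oppr0 => rho [? H ? _]; exists rho; split => //.
by move=> x /H[? E]; split => //; rewrite -[in RHS]E opprK.
Qed.

End Inverse.

Section Uniqueness.
Context {R : realType}.
Implicit Types (x r s : R).

Lemma gronwall (z dz : R -> R) (L c d : R) : c <= d ->
  {within `[c, d], continuous z} ->
  (forall x, c < x < d -> is_derive x 1 z (dz x)) ->
  (forall x, c < x < d -> dz x <= L * z x) -> z c = 0 -> z d <= 0.
Proof.
move=> cd cz hz dzL zc.
have dE x : is_derive x 1 (fun y : R => expR (- L * y)) (expR (- L * x) * - L).
  have dl : is_derive x 1 (fun y : R => - L * y) (- L).
    by apply: is_derive_eq (derM (derC (- L) x) (derI x)) _; ring.
  exact: der_comp (is_derive_expR _) dl.
have : - (z c * expR (- L * c)) <= - (z d * expR (- L * d)).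
  apply: (@mono_ge _ (fun y => - (z y * expR (- L * y)))
    (fun y => - (z y * (expR (- L * y) * - L) + expR (- L * y) * dz y)) _ _ cd).
  - apply: contN; apply: contM cz _.
    by apply: (der_cont_on (df := fun x => expR (- L * x) * - L)).
  - by move=> x /hz h; exact: derN (derM h (dE x)).
  - move=> x /dzL; rewrite -subr_ge0 => h.
    rewrite (_ : - _ = expR (- L * x) * (L * z x - dz x)); last by ring.
    by rewrite mulr_ge0// expR_ge0.
by rewrite zc mul0r oppr0 oppr_ge0 pmulr_lle0// expR_gt0.
Qed.

Lemma curve_unique (N : nat) (g G : R -> R) (c d : R) (r1 p1 r2 p2 : R -> R) :
  c < d -> curve N g c d r1 p1 -> curve N g c d r2 p2 ->
  {within `[c, d], continuous G} -> (forall x, c < x < d -> is_derive x 1 G (g x)) ->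
  (forall x, c <= x <= d -> 0 < p1 x) -> (forall x, c <= x <= d -> 0 < p2 x) ->
  r1 c = r2 c -> p1 c = p2 c -> r1 d = r2 d /\ p1 d = p2 d.
Proof.
move=> cd C1 C2 cG dG p10 p20 rc pc.
have r10 x : c <= x <= d -> 0 < r1 x by exact: (cv_r0 C1).
have r20 x : c <= x <= d -> 0 < r2 x by exact: (cv_r0 C2).
pose kap x := 2 * ((p1 x + p2 x) * p1 x * p2 x)^-1 +
              N.+1%:R * (p2 x * (r1 x * r2 x)^-1).
have ck : {within `[c, d], continuous kap}.
  have [cr1 cp1] := (cv_contr C1, cv_contp C1).
  have [cr2 cp2] := (cv_contr C2, cv_contp C2).
  apply: contD; apply: contM; try exact: cont_cst.
    apply: contV; first by apply: contM (cp2); apply: contM (cp1); exact: contD.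
    by move=> x xcd; rewrite gt_eqF// !mulr_gt0 ?addr_gt0 ?p10 ?p20.
  apply: contM (cp2) _; apply: contV; first exact: contM.
  by move=> x xcd; rewrite gt_eqF// mulr_gt0 ?r10 ?r20.
have [x0 _ kmax] := EVT_max (ltW cd) ck.
pose X x := r1 x - r2 x.
pose Y x := energy G p1 x - energy G p2 x.
pose z x := X x ^+ 2 + Y x ^+ 2.
have cX : {within `[c, d], continuous X}.
  by apply: contB; [exact: (cv_contr C1)|exact: (cv_contr C2)].
have cY : {within `[c, d], continuous Y}.
  by apply: contB; apply: cont_energy cG; [exact: (cv_contp C1)|exact: (cv_contp C2)].
have zd : z d <= 0.
  apply: (@gronwall z (fun x => 2 * X x * ((p1 x)^-1 - (p2 x)^-1) +
     2 * Y x * (- (N.+1%:R * p1 x / r1 x) - - (N.+1%:R * p2 x / r2 x))) (kap x0) c d).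
  - exact: ltW.
  - by apply: contD; exact: contX.
  - move=> x xcd.
    apply: is_derive_eq (derD (derX 2 (derB (cv_derr C1 xcd) (cv_derr C2 xcd)))
      (derX 2 (derB (der_energy C1 xcd (dG _ xcd)) (der_energy C2 xcd (dG _ xcd))))) _.
    by rewrite /= !expr1.
  - move=> x xcd; have xcd' : c <= x <= d by case/andP: xcd => /ltW -> /ltW.
    apply: (@le_trans _ _ (kap x * z x)); last first.
      rewrite ler_wpM2r ?addr_ge0 ?sqr_ge0//.
      by apply: kmax; rewrite in_itv.
    have [q1 q2 s1 s2] := And4 (p10 x xcd') (p20 x xcd') (r10 x xcd') (r20 x xcd').
    have EY : Y x = (p1 x ^+ 2 - p2 x ^+ 2) / 2 by rewrite /Y /energy; field.
    have n0 : 0 <= N.+1%:R :> R by [].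
    rewrite (_ : _ + _ = - (2 * ((p1 x + p2 x) * p1 x * p2 x)^-1) * (2 * X x * Y x)
       + N.+1%:R * (p2 x * (r1 x * r2 x)^-1) * (2 * X x * Y x)
       - N.+1%:R * (2 / ((p1 x + p2 x) * r1 x)) * (2 * Y x ^+ 2)); last first.
      rewrite EY /X; field.
      by rewrite !gt_eqF// addr_gt0.
    have A0 : 0 <= 2 * ((p1 x + p2 x) * p1 x * p2 x)^-1.
      by rewrite mulr_ge0// invr_ge0 ltW// !mulr_gt0// addr_gt0.
    have B0 : 0 <= N.+1%:R * (p2 x * (r1 x * r2 x)^-1).
      by rewrite mulr_ge0// divr_ge0 ?ltW// mulr_gt0.
    have D0 : 0 <= N.+1%:R * (2 / ((p1 x + p2 x) * r1 x)) * (2 * Y x ^+ 2).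
      have inv0 : 0 <= ((p1 x + p2 x) * r1 x)^-1.
        by rewrite invr_ge0 ltW// mulr_gt0// addr_gt0.
      by apply: mulr_ge0; [rewrite !mulr_ge0|rewrite pmulr_rge0 ?sqr_ge0].
    rewrite /kap /z; move: A0 B0 D0.
    move: (2 * (_)^-1) (N.+1%:R * (p2 x * _)) (_ * (2 * Y x ^+ 2)) => A B' D A0 B0 D0.
    have H1 : 0 <= A * (X x + Y x) ^+ 2 by rewrite mulr_ge0// sqr_ge0.
    have H2 : 0 <= B' * (X x - Y x) ^+ 2 by rewrite mulr_ge0// sqr_ge0.
    by move: H1 H2; rewrite !expr2; lra.
  - by rewrite /z /X /Y /energy rc pc !subrr expr0n addr0.
have dcd : c <= d <= d by rewrite lexx ltW.
have X0 : X d = 0.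
  apply/eqP; rewrite -sqrf_eq0 eq_le sqr_ge0 andbT.
  by apply: le_trans zd; rewrite /z ler_wpDr// sqr_ge0.
have Y0 : Y d = 0.
  apply/eqP; rewrite -sqrf_eq0 eq_le sqr_ge0 andbT.
  by apply: le_trans zd; rewrite /z ler_wpDl// sqr_ge0.
split; first by apply/eqP; rewrite -subr_eq0; apply/eqP.
move: Y0; rewrite /Y /energy => Y0.
have /eqP : p1 d ^+ 2 = p2 d ^+ 2 by lra.
by rewrite eqrXn2 ?(ltW (p10 _ dcd)) ?(ltW (p20 _ dcd))// => /eqP.
Qed.

Context (f : R -> R) (B beta : R).
Context (reg : regular_nonlinearity f) (sgn : sign_condition f B beta).
Context (N : nat) (a b : R) (u du v dv : R -> R).
Context (a0 : 0 < a) (ab : a < b) (Su : sol N f a b u du) (Sv : sol N f a b v dv).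

Lemma f_lipschitz l h : 0 < l -> exists L, forall x y,
  l <= x <= h -> l <= y <= h -> `|f x - f y| <= L * `|x - y|.
Proof.
move=> l0; have [lh|hl] := leP l h; last first.
  by exists 0 => x y /andP[lx xh]; move: (le_trans lx xh); rewrite leNgt hl.
have cf' : {within `[l, h], continuous (fun x => `|derive1 f x|)}.
  apply: (@continuous_in_subspaceT) => x; rewrite inE/= in_itv/= => /andP[lx _].
  apply: continuous_comp; last exact: norm_continuous.
  by case: reg => _ + _ => /(_ x (lt_le_trans l0 lx))[].
have [c _ hc] := EVT_max lh cf'.
exists `|derive1 f c|.
have main x y : l <= x <= h -> l <= y <= h -> x <= y ->
    `|f x - f y| <= `|derive1 f c| * `|x - y|.
  move=> /andP[lx xh] /andP[ly yh] xy.
  have pos z : x <= z <= y -> 0 < z.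
    by move=> /andP[xz _]; rewrite (lt_le_trans l0)// (le_trans lx).
  have [z] : exists2 z, z \in `[x, y] & f y - f x = derive1 f z * (y - x).
    apply: MVT_segment => //.
      move=> z; rewrite in_itv/= => /andP[xz zy]; apply: (f_der reg).
      by apply: pos; rewrite !ltW.
    apply: (der_cont_on (df := derive1 f)) => z /pos z0; exact: (f_der reg z0).
  rewrite in_itv/= => /andP[xz zy] E.
  rewrite distrC E normrM [`|x - y|]distrC ler_wpM2r//; apply: hc.
  by rewrite in_itv/= (le_trans lx)// (le_trans zy).
move=> x y hx hy; have [xy|/ltW yx] := leP x y; first exact: main.
by rewrite distrC [`|x - y|]distrC; exact: main.
Qed.

Lemma sol_unique_from c : a < c < b -> u c = v c -> du c = dv c ->
  forall r, c <= r < b -> u r = v r.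
Proof.
move=> /andP[ac cb] uc duc d /andP[cd db].
have oo r : c <= r <= d -> a < r < b.
  by move=> /andP[cr rd]; rewrite (lt_le_trans ac)// (le_lt_trans rd).
have cu : {within `[c, d], continuous u}.
  exact: cont_sub (ltW ac) (ltW db) (sol_cu Su).
have cv : {within `[c, d], continuous v}.
  exact: cont_sub (ltW ac) (ltW db) (sol_cu Sv).
have [l1 + hl1] := EVT_min cd cu; rewrite in_itv/= => l1cd.
have [l2 + hl2] := EVT_min cd cv; rewrite in_itv/= => l2cd.
have [h1 _ hh1] := EVT_max cd cu.
have [h2 _ hh2] := EVT_max cd cv.
pose l := Num.min (u l1) (v l2); pose h := Num.max (u h1) (v h2).
have l0 : 0 < l by rewrite lt_min (sol_pos Su) ?oo// (sol_pos Sv) ?oo.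
have [L HL] := @f_lipschitz l h l0.
have ulh r : c <= r <= d -> l <= u r <= h.
  by move=> rcd; rewrite ge_min hl1 ?in_itv//= le_max hh1 ?in_itv.
have vlh r : c <= r <= d -> l <= v r <= h.
  by move=> rcd; rewrite ge_min hl2 ?in_itv//= ?orbT// le_max hh2 ?in_itv//= orbT.
pose X x := u x - v x; pose Y x := du x - dv x.
have zd : X d ^+ 2 + Y d ^+ 2 <= 0.
  apply: (@gronwall (fun x => X x ^+ 2 + Y x ^+ 2) (fun x => 2 * X x * Y x +
     2 * Y x * ((- (N.+1%:R / x * du x) - f (u x)) - (- (N.+1%:R / x * dv x) - f (v x))))
     (1 + `|L|) c d).
  - by [].
  - apply: contD; apply: contX; apply: contB => //.
      exact: cont_sub (ltW ac) (ltW db) (sol_cdu Su).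
    exact: cont_sub (ltW ac) (ltW db) (sol_cdu Sv).
  - move=> x /andP[cx xd]; have xab : a < x < b by apply: oo; rewrite !ltW.
    apply: is_derive_eq (derD (derX 2 (derB (sol_u Su xab) (sol_u Sv xab)))
       (derX 2 (derB (sol_du Su xab) (sol_du Sv xab)))) _.
    by rewrite /= !expr1.
  - move=> x /andP[cx xd]; have xcd : c <= x <= d by rewrite !ltW.
    have xpos : 0 < x by rewrite (lt_trans a0)//; case/andP: (oo x xcd).
    have := HL _ _ (ulh x xcd) (vlh x xcd).
    rewrite -/(X x); set Fx := f (u x) - f (v x) => HF.
    rewrite (_ : _ + _ = 2 * X x * Y x - 2 * Y x * Fx - 2 * (N.+1%:R / x * Y x ^+ 2)); last first.
      by rewrite /Fx /Y; ring.
    have H1 : 0 <= N.+1%:R / x * Y x ^+ 2 by rewrite mulr_ge0 ?sqr_ge0// divr_ge0// ltW.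
    have H2 : - (2 * Y x * Fx) <= 2 * (`|Y x| * (`|L| * `|X x|)).
      have : - (Y x * Fx) <= `|Y x| * `|Fx| by rewrite -normrM -normrN ler_norm.
      have : `|Y x| * `|Fx| <= `|Y x| * (`|L| * `|X x|).
        rewrite ler_wpM2l// (le_trans HF)// ler_wpM2r// ler_norm//.
      by lra.
    have H3 : 0 <= (X x - Y x) ^+ 2 by exact: sqr_ge0.
    have H4 : 0 <= `|L| * (`|X x| - `|Y x|) ^+ 2 by rewrite mulr_ge0// sqr_ge0.
    have X2 : X x ^+ 2 = `|X x| ^+ 2 by rewrite real_normK// num_real.
    have Y2 : Y x ^+ 2 = `|Y x| ^+ 2 by rewrite real_normK// num_real.
    have H5 : `|L| * (2 * (`|Y x| * `|X x|)) <= `|L| * (X x ^+ 2 + Y x ^+ 2).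
      rewrite X2 Y2; move: H4; rewrite -subr_ge0 => H4.
      by rewrite -subr_ge0 -mulrBr mulr_ge0//; have := sqr_ge0 (`|X x| - `|Y x|);
        rewrite !expr2; lra.
    by move: H1 H2 H3 H5; rewrite !expr2; lra.
  - by rewrite /X /Y uc duc !subrr expr0n addr0.
apply/eqP; rewrite -subr_eq0 -sqrf_eq0 eq_le sqr_ge0 andbT.
by apply: le_trans zd; rewrite ler_wpDr// sqr_ge0.
Qed.

Lemma sol_unique : du a = dv a -> forall r, a <= r <= b -> u r = v r.
Proof.
move=> duv.
have [m [[mab dm] bm upos _ _]] := sol_shape reg sgn a0 ab Su.
have [l [[lab dl] bl vpos _ _]] := sol_shape reg sgn a0 ab Sv.
have [rho [C1 rho1 rhoK]] := rising_branch a0 Su mab dm upos.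
have [tau [C2 tau1 tauK]] := rising_branch a0 Sv lab dl vpos.
have [B0 Bb _] := sign_order sgn.
have M0 : 0 < u m by exact: le_lt_trans (le_trans B0 Bb) bm.
have L0 : 0 < v l by exact: le_lt_trans (le_trans B0 Bb) bl.
have /andP[am mb] := mab; have /andP[al lb] := lab.
have rho0 : rho 0 = a by rewrite -(sol_a Su) rhoK// lexx ltW.
have tau0 : tau 0 = a by rewrite -(sol_a Sv) tauK// lexx ltW.
have eq x : 0 < x -> x < u m -> x < v l -> rho x = tau x /\ du (rho x) = dv (tau x).
  move=> x0 xm xl.
  have D1 := curve_sub (lexx 0) (ltW xm) C1.
  have D2 := curve_sub (lexx 0) (ltW xl) C2.
  apply: (curve_unique x0 D1 D2 (F_cont reg (ltW x0))).
  - by move=> y /andP[y0 _]; exact: (F_der reg y0).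
  - move=> y /andP[y0 yx]; apply: upos.
    have [|/andP[-> +] E] := rho1 y; first by rewrite y0 ltW// (le_lt_trans yx).
    rewrite le_eqVlt => /predU1P[H|//]; move: (le_lt_trans yx xm).
    by rewrite -E H ltxx.
  - move=> y /andP[y0 yx]; apply: vpos.
    have [|/andP[-> +] E] := tau1 y; first by rewrite y0 ltW// (le_lt_trans yx).
    rewrite le_eqVlt => /predU1P[H|//]; move: (le_lt_trans yx xl).
    by rewrite -E H ltxx.
  - by rewrite rho0 tau0.
  - by rewrite rho0 tau0.
pose x := Num.min (u m) (v l) / 2.
have [x0 xm xl] : [/\ 0 < x, x < u m & x < v l].
  have : 0 < Num.min (u m) (v l) by rewrite lt_min M0.
  have : Num.min (u m) (v l) <= u m by rewrite ge_min lexx.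
  have : Num.min (u m) (v l) <= v l by rewrite ge_min lexx orbT.
  by rewrite /x; move: (Num.min _ _) => t *; split; lra.
have xum : 0 <= x <= u m by rewrite !ltW.
have xvl : 0 <= x <= v l by rewrite !ltW.
have [E dE] := eq x x0 xm xl.
have [/andP[ac cm] uc] := rho1 x xum; have [/andP[_ cl] vc] := tau1 x xvl.
have ac' : a < rho x.
  rewrite lt_neqAle ac andbT; apply/eqP => H.
  by move: x0; rewrite -uc -H (sol_a Su) ltxx.
have cab : a < rho x < b by rewrite ac' (le_lt_trans cm).
have after r : rho x <= r < b -> u r = v r.
  apply: sol_unique_from cab _ _ r; first by rewrite uc E vc.
  by rewrite dE E.
move=> r /andP[]; rewrite le_eqVlt => /predU1P[<- _|ar]; first by rewrite (sol_a Su) (sol_a Sv).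
rewrite le_eqVlt => /predU1P[->|rb]; first by rewrite (sol_b Su) (sol_b Sv).
have [cr|rc] := leP (rho x) r; first by rewrite after// cr.
have rm : r < m by exact: lt_le_trans cm.
have ur : 0 < u r by apply: (sol_pos Su); rewrite ar.
have urx : u r < x.
  rewrite -uc; apply: (mono_gt rc (df := du)).
  - apply: cont_sub (sol_cu Su); first exact: ltW.
    by case/andP: cab => _ /ltW.
  - move=> y /andP[ry yc]; apply: (sol_u Su); rewrite (lt_trans ar)//=.
    by rewrite (lt_trans yc)//; case/andP: cab.
  - by move=> y /andP[ry yc]; apply: upos; rewrite (ltW (lt_trans ar ry)) (lt_le_trans yc).
have [Er _] := eq _ ur (lt_trans urx xm) (lt_trans urx xl).
have [|_ <-] := tau1 (u r); first by rewrite !ltW// (lt_trans urx).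
by rewrite -Er rhoK// !ltW.
Qed.

Context (sup : superlinear f B beta).

Lemma sturm t1 t2 : a <= t1 -> t1 < t2 -> t2 <= b -> u t1 = B -> u t2 = B ->
  (forall r, t1 < r < t2 -> B < u r) -> (forall r, t1 <= r <= t2 -> u r <= v r) ->
  0 < du t1 -> du t2 <= 0 ->
  v t1 = B /\ forall r, t1 < r < t2 -> f (v r) * (u r - B) = f (u r) * (v r - B).
Proof.
move=> at1 t12 t2b ut1 ut2 uB uv du1 du2.
have oo r : t1 < r < t2 -> a < r < b.
  by move=> /andP[h1 h2]; rewrite (le_lt_trans at1)// (lt_le_trans h2).
have t10 : 0 < t1 by exact: lt_le_trans a0 at1.
pose W r := r ^+ N.+1 * (du r * (v r - B) - dv r * (u r - B)).
pose dW r := r ^+ N.+1 * (f (v r) * (u r - B) - f (u r) * (v r - B)).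
have cW : {within `[t1, t2], continuous W}.
  apply: (cont_sub at1 t2b); apply: contM; first exact: (contX (f := fun r => r) (@cont_id R a b)).
  apply: contB; apply: contM.
  - exact: (sol_cdu Su).
  - by apply: contB; [exact: (sol_cu Sv)|exact: cont_cst].
  - exact: (sol_cdu Sv).
  - by apply: contB; [exact: (sol_cu Su)|exact: cont_cst].
have hW r : t1 < r < t2 -> is_derive r 1 W (dW r).
  move=> rt; have rab := oo r rt.
  have r0 : r != 0 by rewrite gt_eqF// (lt_trans t10)//; case/andP: rt.
  apply: is_derive_eq (derM (derX N.+1 (derI r)) (derB
    (derM (sol_du Su rab) (derB (sol_u Sv rab) (derC B r)))
    (derM (sol_du Sv rab) (derB (sol_u Su rab) (derC B r))))) _.
  by rewrite /dW /= exprS; field.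
have dW0 r : t1 < r < t2 -> 0 <= dW r.
  move=> rt; have /andP[t1r rt2] := rt; have uBr := uB r rt.
  have uvr : u r <= v r by apply: uv; rewrite !ltW.
  rewrite mulr_ge0 ?exprn_ge0 ?(ltW (lt_trans t10 t1r))// subr_ge0.
  have := quot_mono reg sgn sup uBr uvr.
  rewrite ler_pdivrMr ?subr_gt0// mulrAC ler_pdivlMr// subr_gt0.
  exact: lt_le_trans uvr.
have Wmono x y : t1 <= x -> x <= y -> y <= t2 -> W x <= W y.
  move=> h1 xy h2; apply: (mono_ge xy (cont_sub h1 h2 cW) (df := dW)).
    by move=> r /andP[xr ry]; apply: hW; rewrite (le_lt_trans h1)// (lt_le_trans ry).
  by move=> r /andP[xr ry]; apply: dW0; rewrite (le_lt_trans h1)// (lt_le_trans ry).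
have vt1 : B <= v t1 by rewrite -ut1 uv// lexx ltW.
have vt2 : B <= v t2 by rewrite -ut2 uv// lexx ltW.
have W1 : 0 <= W t1.
  rewrite /W ut1 subrr mulr0 subr0 !mulr_ge0 ?subr_ge0 ?(ltW du1)//.
  by rewrite exprn_ge0// ltW.
have W2 : W t2 <= 0.
  rewrite /W ut2 subrr mulr0 subr0 mulr_ge0_le0//.
    by rewrite exprn_ge0// ltW// (lt_trans t10).
  by rewrite mulr_le0_ge0// subr_ge0.
have W10 : W t1 = 0.
  by apply/eqP; rewrite eq_le W1 andbT (le_trans (Wmono _ _ _ (ltW t12) _)).
split.
  move: W10; rewrite /W ut1 subrr mulr0 subr0 => /eqP.
  rewrite !mulf_eq0 (gt_eqF du1) orFb expf_eq0 (gt_eqF t10) andbF orFb subr_eq0.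
  by move/eqP.
move=> r rt; have /andP[t1r rt2] := rt.
apply/eqP; rewrite -subr_eq0; apply/eqP.
have : dW r = 0.
  apply/eqP; rewrite eq_le dW0// andbT leNgt; apply/negP => h.
  have [e e0 [H _]] := der_pos_near (hW r rt) h.
  have [y [ry ye /ltW yt]] := right_point rt2 e0.
  have := H y; rewrite ry ye => /(_ isT).
  have := Wmono t1 r (lexx _) (ltW t1r) (ltW rt2).
  have := Wmono y t2 (ltW (lt_trans t1r ry)) yt (lexx _).
  by lra.
move/eqP; rewrite mulf_eq0 expf_eq0 gt_eqF ?andbF ?orFb; last exact: lt_trans t1r.
by move/eqP.
Qed.

End Uniqueness.

Section Profile.
Context {R : realType} (f : R -> R) (B beta : R).
Context (reg : regular_nonlinearity f) (sgn : sign_condition f B beta).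
Context (N : nat) (a b : R) (a0 : 0 < a) (ab : a < b).
Implicit Types r s x y : R.

Local Notation F := (primitive0 f).
Local Notation K := (fun t => primitive0 f t / f t).

Definition neg_force x := - f (- x).
Definition neg_primitive x := F (- x).
Definition neg_quotient x := - K (- x).

(* The maximum point m of u, and the inverses rho of u on [a, m] and tau of
   - u on [m, b]. *)
Record profile (u du : R -> R) (m : R) (rho tau : R -> R) : Prop := Profile {
  pr_sol : sol N f a b u du;
  pr_m : a < m < b;
  pr_dm : du m = 0;
  pr_beta : beta < u m;
  pr_up : forall r, a <= r < m -> 0 < du r;
  pr_down : forall r, m < r < b -> du r < 0;
  pr_db : du b <= 0;
  pr_rho : curve N f 0 (u m) rho (fun x => du (rho x));
  pr_rhoP : forall x, 0 <= x <= u m -> a <= rho x <= m /\ u (rho x) = x;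
  pr_rhoK : forall r, a <= r <= m -> rho (u r) = r;
  pr_tau : curve N neg_force (- u m) 0 tau (fun x => - du (tau x));
  pr_tauP : forall x, - u m <= x <= 0 -> m <= tau x <= b /\ u (tau x) = - x;
  pr_tauK : forall r, m <= r <= b -> tau (- u r) = r }.

Lemma sol_profile u du : sol N f a b u du ->
  exists m rho tau, profile u du m rho tau.
Proof.
move=> S; have [m [[mab dm] bm up down db]] := sol_shape reg sgn a0 ab S.
have [rho [? ? ?]] := rising_branch a0 S mab dm up.
have [tau [? ? ?]] := falling_branch a0 S mab dm down db.
by exists m, rho, tau.
Qed.

Section One.
Context (u du : R -> R) (m : R) (rho tau : R -> R) (Q : profile u du m rho tau).

Let beta0 : 0 <= beta.
Proof. by have [B0 Bb _] := sign_order sgn; exact: le_trans Bb. Qed.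

Lemma pr_M0 : 0 < u m. Proof. exact: le_lt_trans (pr_beta Q). Qed.

Lemma pr_rho0 : rho 0 = a.
Proof.
by rewrite -(sol_a (pr_sol Q)) (pr_rhoK Q)// lexx ltW//; case/andP: (pr_m Q).
Qed.

Lemma pr_rhoM : rho (u m) = m.
Proof. by rewrite (pr_rhoK Q)// lexx ltW//; case/andP: (pr_m Q). Qed.

Lemma pr_tau0 : tau 0 = b.
Proof.
rewrite -[in LHS]oppr0 -(sol_b (pr_sol Q)) (pr_tauK Q)// lexx ltW//.
by case/andP: (pr_m Q).
Qed.

Lemma pr_tauM : tau (- u m) = m.
Proof. by rewrite (pr_tauK Q)// lexx ltW//; case/andP: (pr_m Q). Qed.

Lemma pr_inc x y : a <= x -> x < y -> y <= m -> u x < u y.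
Proof.
move=> ax xy ym; have /andP[am mb] := pr_m Q.
apply: (mono_gt xy (df := du)).
- exact: cont_sub ax (le_trans ym (ltW mb)) (sol_cu (pr_sol Q)).
- move=> z /andP[xz zy]; apply: (sol_u (pr_sol Q)).
  by rewrite (le_lt_trans ax)// (lt_trans zy)// (le_lt_trans ym).
- move=> z /andP[xz zy]; apply: (pr_up Q).
  by rewrite (ltW (le_lt_trans ax xz)) (lt_le_trans zy).
Qed.

Lemma pr_dec x y : m <= x -> x < y -> y <= b -> u y < u x.
Proof.
move=> mx xy yb; have /andP[am mb] := pr_m Q; rewrite -ltrN2.
apply: (@mono_gt _ (fun z => - u z) (fun z => - du z) _ _ xy).
- apply: contN; exact: cont_sub (le_trans (ltW am) mx) yb (sol_cu (pr_sol Q)).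
- move=> z /andP[xz zy]; apply/derN/(sol_u (pr_sol Q)).
  by rewrite (lt_trans am)/= ?(lt_le_trans zy)// (le_lt_trans mx).
- move=> z /andP[xz zy]; rewrite oppr_gt0; apply: (pr_down Q).
  by rewrite (le_lt_trans mx)// (lt_le_trans zy).
Qed.

Lemma pr_level_gt s r : 0 <= s <= u m -> rho s < r < tau (- s) -> s < u r.
Proof.
move=> sM /andP[sr rs].
have [/andP[as_ sm] E] := pr_rhoP Q sM.
have [|/andP[ms sb]] := @pr_tauP _ _ _ _ _ Q (- s).
  by rewrite lerN2 oppr_le0 andbC.
rewrite opprK => E'.
have [rm|mr] := leP r m; first by rewrite -[ltLHS]E pr_inc.
by rewrite -[ltLHS]E' pr_dec// ltW.
Qed.

Lemma pr_level_ge s r : 0 <= s <= u m -> rho s <= r <= tau (- s) -> s <= u r.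
Proof.
move=> sM /andP[]; rewrite le_eqVlt => /predU1P[<- _|sr].
  by have [_ ->] := pr_rhoP Q sM.
rewrite le_eqVlt => /predU1P[->|rs].
  by rewrite (pr_tauP Q _).2 ?opprK// lerN2 oppr_le0 andbC.
by rewrite ltW// pr_level_gt// sr.
Qed.

Lemma pr_rho_speed s : 0 <= s < u m -> 0 < du (rho s).
Proof.
move=> /andP[s0 sM]; have [|/andP[h1 h2] E] := @pr_rhoP _ _ _ _ _ Q s.
  by rewrite s0 ltW.
apply: (pr_up Q); rewrite h1/= lt_neqAle h2 andbT; apply/eqP => H.
by move: sM; rewrite -E H ltxx.
Qed.

Lemma pr_rho_energy s : 0 <= s <= u m -> 0 <= energy F (fun x => du (rho x)) s.
Proof.
move=> sM; have [/andP[h1 h2] E] := pr_rhoP Q sM.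
rewrite /energy -[in F s]E; apply: (sol_energy_ge0 reg a0 ab (pr_sol Q)).
by rewrite h1 (le_trans h2)// ltW//; case/andP: (pr_m Q).
Qed.

Lemma pr_tau_energy x : - u m <= x <= 0 ->
  0 <= energy neg_primitive (fun x => - du (tau x)) x.
Proof.
move=> xM; have [/andP[h1 h2] E] := pr_tauP Q xM.
rewrite /energy /neg_primitive -E sqrrN; apply: (sol_energy_ge0 reg a0 ab (pr_sol Q)).
by rewrite h2 andbT (le_trans _ h1)// ltW//; case/andP: (pr_m Q).
Qed.

End One.

Context (sub : subcritical N.+2 f beta) (sup : superlinear f B beta).

Lemma neg_primitive_cont x : x <= 0 -> {within `[x, 0], continuous neg_primitive}.
Proof.
move=> x0; have h : 0 <= - x by rewrite oppr_ge0.
apply: (cont_comp (F_cont reg h)); first exact: contN (@cont_id _ x 0).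
by move=> y /andP[xy y0]; rewrite oppr_ge0 y0 lerN2.
Qed.

Lemma neg_primitive_der x : x < 0 -> is_derive x 1 neg_primitive (neg_force x).
Proof.
rewrite -oppr_gt0 => /(F_der reg) h.
by apply: is_derive_eq (der_comp h (derN (derI x))) _; rewrite /neg_force mulrN1.
Qed.

Lemma neg_quotient_cont x : x <= - beta -> {within `[x, - beta], continuous neg_quotient}.
Proof.
move=> xb; have h : beta <= - x by rewrite lerNr.
apply: contN; apply: (cont_comp (K_cont reg sgn sup h)); last first.
  by move=> y /andP[xy yb]; rewrite lerN2 xy lerNr yb.
exact: contN (@cont_id _ x (- beta)).
Qed.

End Profile.

Section Conclusion.
Context {R : realType} (f : R -> R) (B beta : R).
Context (reg : regular_nonlinearity f) (sgn : sign_condition f B beta).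
Context (N : nat) (a b : R) (a0 : 0 < a) (ab : a < b).
Context (sub : subcritical N.+2 f beta) (sup : superlinear f B beta).
Implicit Types r s x y : R.

Local Notation F := (primitive0 f).
Local Notation K := (fun t => primitive0 f t / f t).
Local Notation fneg := (neg_force f).
Local Notation Fneg := (neg_primitive f).
Local Notation Kneg := (neg_quotient f).

Let B0 : 0 <= B. Proof. by have [] := sign_order sgn. Qed.
Let Bb : B <= beta. Proof. by have [] := sign_order sgn. Qed.
Let fB s : B < s -> 0 < f s. Proof. by have [_ _] := sign_order sgn; apply. Qed.
Let beta0 : 0 <= beta. Proof. exact: le_trans Bb. Qed.

Let riseF d : beta <= d -> {within `[beta, d], continuous F}.
Proof. by move=> h; exact: (cont_sub beta0 (lexx d)) (F_cont reg (le_trans beta0 h)). Qed.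

Let riseF' d x : beta < x < d -> is_derive x 1 F (f x).
Proof. by move=> /andP[h _]; apply: (F_der reg); exact: le_lt_trans h. Qed.

Let riseK' d x : beta < x < d -> is_derive x 1 K (derive1 K x).
Proof.
by move=> /andP[h _]; apply: (K_derivable reg sgn); exact: le_lt_trans h.
Qed.

Let riseKf d x : beta < x < d -> K x * f x = F x.
Proof. by move=> /andP[h _]; rewrite divfK// gt_eqF// fB// (le_lt_trans Bb). Qed.

Let riseK0 d x : beta < x < d -> 0 <= 2 * N.+2%:R * derive1 K x - N%:R.
Proof. by move=> /andP[h _]; exact: (K_speed sub h). Qed.

Let fallF c : c <= - beta -> {within `[c, - beta], continuous Fneg}.
Proof.
move=> h; have c0 : c <= 0 by rewrite (le_trans h)// oppr_le0.
by apply: cont_sub (neg_primitive_cont reg c0); rewrite ?oppr_le0.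
Qed.

Let fall_gt c x : c < x < - beta -> beta < - x.
Proof. by move=> /andP[_ h]; rewrite ltrNr. Qed.

Let fallF' c x : c < x < - beta -> is_derive x 1 Fneg (fneg x).
Proof.
by move=> /fall_gt h; apply: (neg_primitive_der reg); rewrite -oppr_gt0 (le_lt_trans beta0).
Qed.

Let fallK' c x : c < x < - beta -> is_derive x 1 Kneg (derive1 K (- x)).
Proof.
move=> /fall_gt h.
have hK : is_derive (- x) 1 K (derive1 K (- x)).
  by apply: (K_derivable reg sgn); exact: le_lt_trans h.
apply: is_derive_eq (derN (der_comp hK (derN (derI x)))) _.
by rewrite mulrN1 opprK.
Qed.

Let fallKf c x : c < x < - beta -> Kneg x * fneg x = Fneg x.
Proof.
move=> /fall_gt h; rewrite /neg_quotient /neg_force mulrNN divfK//.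
by rewrite gt_eqF// fB// (le_lt_trans Bb).
Qed.

Let fallK0 c x : c < x < - beta -> 0 <= 2 * N.+2%:R * derive1 K (- x) - N%:R.
Proof. by move=> /fall_gt h; exact: (K_speed sub h). Qed.

Let fallf0 c x : c < x < - beta -> fneg x <= 0.
Proof.
by move=> /fall_gt h; rewrite oppr_le0 ltW// fB// (le_lt_trans Bb).
Qed.

Section One.
Context (u du : R -> R) (m : R) (rho tau : R -> R).
Context (Q : profile f beta N a b u du m rho tau).

Local Notation prise := (pohozaev N F K rho (fun x => du (rho x))).
Local Notation pfall := (pohozaev N Fneg Kneg tau (fun x => - du (tau x))).

Lemma pr_rise : curve N f beta (u m) rho (fun x => du (rho x)).
Proof. exact: (curve_sub beta0 (lexx _) (pr_rho Q)). Qed.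

Lemma pr_fall : curve N fneg (- u m) (- beta) tau (fun x => - du (tau x)).
Proof. by apply: curve_sub (pr_tau Q) => //; rewrite oppr_le0. Qed.

Lemma prise_mono x y : beta <= x -> x <= y -> y <= u m -> prise x <= prise y.
Proof.
have bM := pr_beta Q.
exact: (pohozaev_mono pr_rise (riseF (ltW bM)) (K_cont reg sgn sup (ltW bM))
  (@riseF' _) (@riseK' _) (@riseKf _) (@riseK0 _)).
Qed.

Lemma pfall_mono x y : - u m <= x -> x <= y -> y <= - beta -> pfall x <= pfall y.
Proof.
have bM : - u m <= - beta by rewrite lerN2 ltW// (pr_beta Q).
exact: (pohozaev_mono pr_fall (fallF bM) (neg_quotient_cont reg sgn sup bM)
  (@fallF' _) (@fallK' _) (@fallKf _) (@fallK0 _)).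
Qed.

Lemma pohozaev_turn : prise (u m) = pfall (- u m).
Proof.
rewrite /pohozaev /momentum (pr_rhoM Q) (pr_tauM Q) (pr_dm Q) /neg_primitive opprK.
by rewrite oppr0 !mulr0.
Qed.

Lemma prise_gt0 : 0 < prise beta.
Proof.
rewrite /pohozaev /= (F_beta sgn) !(mulr0, mul0r, addr0).
have M0 : 0 <= beta < u m by rewrite beta0 (pr_beta Q).
rewrite mulr_gt0 ?exprn_gt0 ?(pr_rho_speed Q)// (cv_r0 pr_rise)// lexx ltW//.
by case/andP: M0.
Qed.

Lemma pfall_gt0 x : - u m <= x <= - beta -> 0 < pfall x.
Proof.
move=> /andP[h1 h2]; apply: lt_le_trans (pfall_mono (lexx _) h1 h2).
rewrite -pohozaev_turn (lt_le_trans prise_gt0)// prise_mono// ltW//.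
exact: (pr_beta Q).
Qed.

Lemma pr_fall_speed x : - u m < x < 0 -> 0 < - du (tau x).
Proof. exact: (cv_p0 (pr_tau Q)). Qed.

End One.

Section Two.
Context (u1 du1 : R -> R) (m1 : R) (rho1 tau1 : R -> R).
Context (u2 du2 : R -> R) (m2 : R) (rho2 tau2 : R -> R).
Context (Q1 : profile f beta N a b u1 du1 m1 rho1 tau1).
Context (Q2 : profile f beta N a b u2 du2 m2 rho2 tau2).
Context (du12 : du1 a < du2 a).

Local Notation M1 := (u1 m1).
Local Notation M2 := (u2 m2).
Local Notation p1 := (fun x => du1 (rho1 x)).
Local Notation p2 := (fun x => du2 (rho2 x)).
Local Notation q1 := (fun x => - du1 (tau1 x)).
Local Notation q2 := (fun x => - du2 (tau2 x)).

Let du1a : 0 < du1 a.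
Proof. by apply: (pr_up Q1); rewrite lexx; case/andP: (pr_m Q1). Qed.

Let rising_start : [/\ rho2 beta <= rho1 beta,
  momentum N rho1 p1 beta < momentum N rho2 p2 beta &
  forall x, 0 <= x < beta -> p1 x < p2 x].
Proof.
have du0 : 0 < du1 a := du1a.
move: beta0; rewrite le_eqVlt => /predU1P[b0|bpos].
  rewrite -b0 /momentum (pr_rho0 Q1) (pr_rho0 Q2); split => //.
    by rewrite ltr_pM2l// exprn_gt0.
  by move=> x /andP[x0 /(le_lt_trans x0)]; rewrite ltxx.
have C1 := curve_sub (lexx 0) (ltW (pr_beta Q1)) (pr_rho Q1).
have C2 := curve_sub (lexx 0) (ltW (pr_beta Q2)) (pr_rho Q2).
have cF := F_cont reg (ltW bpos).
have hF x : 0 < x < beta -> is_derive x 1 F (f x).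
  by move=> /andP[x0 _]; exact: (F_der reg x0).
have F0' x : 0 < x < beta -> F x < 0 by exact: (F_lt0 reg sgn).
have e1 x : 0 <= x <= beta -> 0 <= energy F p1 x.
  move=> /andP[x0 xb]; apply: (pr_rho_energy reg a0 ab Q1).
  by rewrite x0 (le_trans xb)// ltW// (pr_beta Q1).
have r21 : rho2 0 <= rho1 0 by rewrite (pr_rho0 Q1) (pr_rho0 Q2).
have A12 i : scaled_energy i F rho1 p1 0 < scaled_energy i F rho2 p2 0.
  rewrite /scaled_energy /energy (pr_rho0 Q1) (pr_rho0 Q2).
  rewrite ltr_pM2l ?exprn_gt0// ltrD2r ltr_pM2r ?invr_gt0//.
  by rewrite ltr_pXn2r ?nnegrE ?(ltW du0)// ltW// (lt_trans du0).
have p1b : 0 < p1 beta.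
  by apply: (pr_rho_speed Q1); rewrite (ltW bpos) (pr_beta Q1).
have [A r21b] := energy_cmp_end bpos C1 C2 cF hF F0' (F_beta sgn) p1b e1 r21 (A12 N).
split; first exact: ltW.
  have bb : 0 <= beta <= beta by rewrite lexx (ltW bpos).
  have h1 := momentum_ge0 C1 bb; have h2 := momentum_ge0 C2 bb.
  rewrite -(@ltr_pXn2r _ 2)// /momentum !exprMn.
  move: A; rewrite /scaled_energy /energy (F_beta sgn) !addr0; lra.
by move=> x /(energy_cmp bpos C1 C2 (leqnn N) cF hF F0' e1 r21 (A12 N))[].
Qed.

Lemma rising_order : [/\ M1 < M2, forall x, 0 < x <= M1 -> rho2 x < rho1 x &
  pohozaev N F K rho1 p1 M1 < pohozaev N F K rho2 p2 M1].
Proof.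
have [r21 qb pb] := rising_start.
have bM1 := pr_beta Q1; have bM2 := pr_beta Q2.
have main d : beta < d -> d <= M1 -> d <= M2 -> forall x, beta <= x <= d ->
    [/\ momentum N rho1 p1 x < momentum N rho2 p2 x, p1 x < p2 x & rho2 x <= rho1 x].
  move=> bd d1 d2.
  have C1 := curve_sub (lexx _) d1 (pr_rise Q1).
  have C2 := curve_sub (lexx _) d2 (pr_rise Q2).
  apply: (rising_cmp bd C1 C2) => // x /andP[bx _].
  by rewrite ltW// fB// (le_lt_trans Bb).
have M12 : M1 < M2.
  rewrite ltNge; apply/negP => M21.
  have [|_ + _] := main M2 bM2 M21 (lexx _) M2; first by rewrite lexx ltW.
  rewrite /= (pr_rhoM Q2) (pr_dm Q2) ltNge (cv_p0' (pr_rho Q1))//.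
  by rewrite M21 ltW// (le_lt_trans beta0).
have M1pos := le_lt_trans beta0 bM1.
have p12 x : 0 <= x <= M1 -> p1 x < p2 x.
  move=> /andP[x0 xM]; have [xb|bx] := ltP x beta; first by rewrite pb// x0.
  by have [|] := main M1 bM1 (lexx _) (ltW M12) x; first by rewrite bx.
have C2 := curve_sub (lexx 0) (ltW M12) (pr_rho Q2).
split => //.
  move=> x xM; apply: (gap_lt (pr_rho Q1) C2 xM).
    move=> y /andP[y0 yx]; apply: p12; rewrite y0 ltW//.
    by rewrite (lt_le_trans yx)//; case/andP: xM.
  by rewrite (pr_rho0 Q1) (pr_rho0 Q2).
have C1' := pr_rise Q1.
have C2' := curve_sub (lexx beta) (ltW M12) (pr_rise Q2).
have cmp := pohozaev_cmp C1' C2' (riseF (ltW bM1)) (K_cont reg sgn sup (ltW bM1))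
  (@riseF' M1) (@riseK' M1) (@riseKf M1) (@riseK0 M1) (lexx _) (ltW bM1) (lexx _).
have : pohozaev N F K rho2 p2 beta - pohozaev N F K rho1 p1 beta <=
       pohozaev N F K rho2 p2 M1 - pohozaev N F K rho1 p1 M1.
  apply: cmp => x /andP[bx xM]; apply: ltW.
  by have [|] := main M1 bM1 (lexx _) (ltW M12) x; first by rewrite !ltW.
suff : pohozaev N F K rho1 p1 beta < pohozaev N F K rho2 p2 beta by lra.
have bb : beta <= beta <= M1 by rewrite lexx ltW.
have r10 := cv_r0 C1' bb; have r20 := cv_r0 C2' bb.
have h1 := momentum_ge0 C1' bb; have h2 := momentum_ge0 C2' bb.
have Pgt0 := prise_gt0 Q2.
move: Pgt0; rewrite /pohozaev/= (F_beta sgn) !(mulr0, mul0r, addr0) => Pgt0.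
have : momentum N rho1 p1 beta ^+ 2 < momentum N rho2 p2 beta ^+ 2.
  by rewrite ltr_pXn2r.
rewrite /momentum => H.
have a1 : 0 < rho1 beta ^+ N by rewrite exprn_gt0.
have a21 : rho2 beta ^+ N <= rho1 beta ^+ N by apply: lerXn2r => //; rewrite nnegrE ltW.
rewrite -(ltr_pM2l a1).
apply: (@lt_le_trans _ _ (rho2 beta ^+ N * (rho2 beta ^+ N.+2 * p2 beta ^+ 2))).
  by move: H; rewrite !exprS !expr0; lra.
by rewrite ler_wpM2r// ltW.
Qed.

Lemma falling_crossing : exists2 s, B < s <= M1 & tau2 (- s) <= tau1 (- s).
Proof.
have [M12 r21 _] := rising_order.
have BM : B < M1 by exact: le_lt_trans (pr_beta Q1).
have M1pos := pr_M0 sgn Q1.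
apply: contrapT => noc.
have tau12 s : B < s <= M1 -> tau1 (- s) < tau2 (- s).
  by move=> sM; rewrite ltNge; apply/negP => h; apply: noc; exists s.
have NM : - M2 <= - M1 by rewrite lerN2 ltW.
have C1 := pr_tau Q1; have C2 := curve_sub NM (lexx 0) (pr_tau Q2).
have tau12' s : B <= s <= M1 -> tau1 (- s) <= tau2 (- s).
  move=> /andP[]; rewrite le_eqVlt => /predU1P[<- _|Bs sM]; last by rewrite ltW// tau12 ?Bs.
  have NBM : - M1 < - B by rewrite ltrN2.
  rewrite -subr_ge0; apply: (cont_left_ge0 (D := fun x => tau2 x - tau1 x) NBM).
    apply: (@cont_sub _ (- M1) 0) => //; first by rewrite oppr_le0.
    by apply: contB; [exact: cv_contr C2|exact: cv_contr C1].
  move=> y /andP[h1 h2]; rewrite subr_ge0 ltW// -[y]opprK tau12//.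
  by rewrite ltrNr h2 lerNl ltW.
have rho21 s : 0 <= s <= M1 -> rho2 s <= rho1 s.
  move=> /andP[]; rewrite le_eqVlt => /predU1P[<- _|s0 sM].
    by rewrite (pr_rho0 Q1) (pr_rho0 Q2).
  by rewrite ltW// r21 ?s0.
have BM' : 0 <= B <= M1 by rewrite B0 ltW.
have M2' s : 0 <= s <= M1 -> 0 <= s <= M2.
  by move=> /andP[-> h]; rewrite (le_trans h)// ltW.
have [/andP[at1 t1m] ut1] := pr_rhoP Q1 BM'.
have NB : - M1 <= - B <= 0 by rewrite lerN2 oppr_le0 andbC.
have [/andP[mt2 t2b] ut2] := pr_tauP Q1 NB.
rewrite opprK in ut2.
have t1m' : rho1 B < m1.
  by rewrite lt_neqAle t1m andbT; apply/eqP => H; move: BM; rewrite -ut1 H ltxx.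
have m1t2 : m1 < tau1 (- B).
  by rewrite lt_neqAle mt2 andbT; apply/eqP => H; move: BM; rewrite -ut2 -H ltxx.
have t12 := lt_trans t1m' m1t2.
have [||||+ fuv] := sturm reg sgn a0 (pr_sol Q1) (pr_sol Q2) sup at1 t12 t2b ut1 ut2.
- by move=> r rt; exact: (pr_level_gt Q1 BM' rt).
- move=> r rt; have Bu : B <= u1 r := pr_level_ge Q1 BM' rt.
  have /andP[t1r rt2] := rt.
  have ar : a <= r := le_trans at1 t1r; have rb : r <= b := le_trans rt2 t2b.
  have uM : u1 r <= M1.
    have [rm|mr|->//] := ltgtP r m1; first by rewrite ltW// (pr_inc Q1).
    by rewrite ltW// (pr_dec Q1).
  have u0M : 0 <= u1 r <= M1 by rewrite (le_trans B0).
  apply: (pr_level_ge Q2 (M2' _ u0M)); apply/andP; split.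
    have [rm|/ltW mr] := leP r m1.
      by have := rho21 _ u0M; rewrite (pr_rhoK Q1)// ar.
    apply: le_trans (rho21 _ u0M) _.
    by have [/andP[_ h] _] := pr_rhoP Q1 u0M; exact: le_trans mr.
  have BuM : B <= u1 r <= M1 by rewrite Bu.
  have [mr|/ltW rm] := leP m1 r.
    by have := tau12' _ BuM; rewrite (pr_tauK Q1)// mr.
  apply: le_trans (tau12' _ BuM).
  have [|/andP[h _] _] := pr_tauP Q1 (x := - u1 r).
    by rewrite lerN2 oppr_le0 andbC.
  exact: le_trans rm h.
- by apply: (pr_up Q1); rewrite at1.
- have := t2b; rewrite le_eqVlt => /predU1P[->|t2b']; first exact: (pr_db Q1).
  by rewrite ltW// (pr_down Q1)// m1t2.
move=> u2t1.
have [Bpos|] := ltP 0 B.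
  have : B < u2 (rho1 B).
    apply: (pr_level_gt Q2 (M2' _ BM')); rewrite r21 ?Bpos ?ltW//=.
    by rewrite (lt_le_trans t12)// tau12'// lexx ltW.
  by rewrite u2t1 ltxx.
move=> B0'; have Be : B = 0 by apply/eqP; rewrite eq_le B0' B0.
have be : B = beta by rewrite Be (sign_B0 sgn Be).
have [_ [_ /(_ be _ M1pos)[s]]] := sup.
rewrite Be add0r => /andP[s0 sM] ns; apply: ns.
have s0M : 0 <= s <= M1 by rewrite !ltW.
have BsM : B < s <= M1 by rewrite Be s0 ltW.
have [/andP[h1 h2] us] := pr_rhoP Q1 s0M.
have [/andP[h3 h4] us2] := pr_rhoP Q2 (M2' _ s0M).
have r21s : rho2 s < rho1 s by apply: r21; rewrite s0 ltW.
pose r := (rho1 s + rho2 s) / 2.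
have [r1 r2] : rho2 s < r /\ r < rho1 s by rewrite /r; split; lra.
have u1r : u1 r < s by rewrite -[ltRHS]us (pr_inc Q1)// (le_trans h3)// ltW.
have u2r : s < u2 r.
  apply: (pr_level_gt Q2 (M2' _ s0M)); rewrite r1/=.
  apply: (lt_trans r2); apply: le_lt_trans h2 _; apply: le_lt_trans (tau12 _ BsM).
  have [|/andP[h _] _] := pr_tauP Q1 (x := - s) => //.
  by rewrite lerN2 oppr_le0 andbC.
have arb : rho1 B < r < tau1 (- B).
  rewrite Be oppr0 (pr_rho0 Q1) (pr_tau0 Q1) (le_lt_trans h3 r1)/=.
  by rewrite (lt_le_trans r2)// (le_trans h2)// ltW//; case/andP: (pr_m Q1).
have Bu1 : B < u1 r by exact: (pr_level_gt Q1 BM' arb).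
have sr : u1 r < s < u2 r by rewrite u1r.
by have := quot_rigid reg sgn sup Bu1 sr (fuv r arb); rewrite Be subr0.
Qed.

Lemma falling_start : exists c, [/\ - M1 <= c < - B,
  tau2 c <= tau1 c, c = - M1 \/ tau2 c = tau1 c,
  momentum N tau1 q1 c < momentum N tau2 q2 c &
  c <= - beta ->
    pohozaev N Fneg Kneg tau1 q1 c < pohozaev N Fneg Kneg tau2 q2 c].
Proof.
have [M12 _ PM] := rising_order.
have [s /andP[Bs sM] ts] := falling_crossing.
have NM : - M2 <= - M1 by rewrite lerN2 ltW.
have M1pos := pr_M0 sgn Q1.
have C1 := pr_tau Q1; have C2 := curve_sub NM (lexx 0) (pr_tau Q2).
have N10 : - M1 < 0 by rewrite oppr_lt0.
have qM : momentum N tau1 q1 (- M1) < momentum N tau2 q2 (- M1).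
  rewrite {1}/momentum (pr_tauM Q1) (pr_dm Q1) oppr0 mulr0.
  have NM1 : - M1 <= - M1 <= 0 by rewrite lexx ltW.
  by apply: (momentum_gt0 C2 NM1); apply: (pr_fall_speed Q2); rewrite ltrN2 M12.
have PM' : pohozaev N Fneg Kneg tau1 q1 (- M1) < pohozaev N Fneg Kneg tau2 q2 (- M1).
  rewrite -(pohozaev_turn Q1); apply: (lt_le_trans PM).
  apply: le_trans (prise_mono Q2 (ltW (pr_beta Q1)) (ltW M12) (lexx _)) _.
  rewrite (pohozaev_turn Q2); apply: (pfall_mono Q2 (lexx _)) => //.
  by rewrite lerN2 ltW// (pr_beta Q1).
have [c [/andP[Mc cs] tc tc' before]] : exists c, [/\ - M1 <= c <= - s,
    tau2 c <= tau1 c, c = - M1 \/ tau2 c = tau1 c &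
    forall x, - M1 <= x < c -> tau1 x <= tau2 x].
  have [tM|tM] := leP (tau2 (- M1)) (tau1 (- M1)).
    exists (- M1); split => //; [by rewrite lexx lerN2|by left|].
    by move=> x /andP[h /(le_lt_trans h)]; rewrite ltxx.
  have sM' : - M1 <= - s by rewrite lerN2.
  have ct : {within `[- M1, - s], continuous (fun x => tau2 x - tau1 x)}.
    apply: (@cont_sub _ (- M1) 0) => //; first by rewrite oppr_le0 ltW// (le_lt_trans B0).
    by apply: contB; [exact: cv_contr C2|exact: cv_contr C1].
  have [||c [/andP[Mc cs] tc pos]] := first_exit sM' ct.
  - by rewrite subr_gt0.
  - by rewrite subr_le0.
  have E : tau2 c = tau1 c by apply/eqP; rewrite -subr_eq0 tc.
  exists c; split; [by rewrite ltW|by rewrite E|by right|].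
  by move=> x /pos; rewrite subr_gt0 => /ltW.
have cB : c < - B by rewrite (le_lt_trans cs)// ltrN2.
have c0 : c < 0 by rewrite (lt_le_trans cB)// oppr_le0.
have q12 x : - M1 <= x <= c -> momentum N tau1 q1 x < momentum N tau2 q2 x.
  move=> /andP[]; rewrite le_eqVlt => /predU1P[<- //|Mx xc].
  have x0 : x <= 0 by rewrite (le_trans xc)// ltW.
  apply: (momentum_cmp N10 C1 C2 _ _ qM); first by rewrite Mx.
  move=> y /andP[My yx]; have yM : - M1 <= y <= 0 by rewrite ltW//= (le_trans (ltW yx)).
  rewrite nmulr_lge0; last first.
    rewrite oppr_lt0 fB// ltrNr (lt_trans yx)// (le_lt_trans xc)//.
  rewrite subr_le0; apply: lerXn2r.
  - by rewrite nnegrE ltW// (cv_r0 C1).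
  - by rewrite nnegrE ltW// (cv_r0 C2).
  - by apply: before; rewrite ltW//= (lt_le_trans yx).
exists c; split => //; [by rewrite Mc|by apply: q12; rewrite Mc lexx|].
move=> cb.
have Mb : - M1 <= - beta by rewrite lerN2 ltW// (pr_beta Q1).
have D1 := pr_fall Q1; have D2 := curve_sub NM (lexx _) (pr_fall Q2).
have := pohozaev_cmp D1 D2 (fallF Mb) (neg_quotient_cont reg sgn sup Mb)
  (@fallF' _) (@fallK' _) (@fallKf _) (@fallK0 _) (lexx _) Mc cb.
move=> H; have : pohozaev N Fneg Kneg tau2 q2 (- M1) - pohozaev N Fneg Kneg tau1 q1 (- M1)
    <= pohozaev N Fneg Kneg tau2 q2 c - pohozaev N Fneg Kneg tau1 q1 c.
  by apply: H => z /andP[h1 h2]; rewrite ltW// q12// !ltW.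
by lra.
Qed.

Lemma no_low_crossing c : - M1 < c -> - beta <= c -> c < 0 -> tau2 c <= tau1 c ->
  scaled_energy 0 Fneg tau1 q1 c < scaled_energy 0 Fneg tau2 q2 c -> False.
Proof.
move=> Mc bc c0 t21 A12.
have [M12 _ _] := rising_order.
have NM : - M2 <= c by rewrite (le_trans _ (ltW Mc))// lerN2 ltW.
have C1 := curve_sub (ltW Mc) (lexx 0) (pr_tau Q1).
have C2 := curve_sub NM (lexx 0) (pr_tau Q2).
have hF x : c < x < 0 -> is_derive x 1 Fneg (fneg x).
  by move=> /andP[_ x0]; exact: (neg_primitive_der reg x0).
have Fn x : c < x < 0 -> Fneg x < 0.
  move=> /andP[cx x0]; apply: (F_lt0 reg sgn).
  by rewrite oppr_gt0 x0 ltrNl (le_lt_trans bc).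
have e1 x : c <= x <= 0 -> 0 <= energy Fneg q1 x.
  move=> /andP[cx x0]; apply: (pr_tau_energy reg a0 ab Q1).
  by rewrite x0 (le_trans (ltW Mc)).
have cmp := energy_cmp c0 C1 C2 (leq0n N) (neg_primitive_cont reg (ltW c0)) hF Fn e1 t21 A12.
have : tau2 0 < tau1 0.
  apply: (gap_lt C1 C2) t21; first by rewrite c0 lexx.
  by move=> y /cmp[].
by rewrite (pr_tau0 Q1) (pr_tau0 Q2) ltxx.
Qed.

Lemma profiles_absurd : False.
Proof.
have [M12 _ _] := rising_order.
have [c [/andP[Mc cB] t21 tE q12 P12]] := falling_start.
have M1pos := pr_M0 sgn Q1.
have c0 : c < 0 by rewrite (lt_le_trans cB)// oppr_le0.
have NM : - M2 <= - M1 by rewrite lerN2 ltW.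
have bM := pr_beta Q1.
have [bc|cb] := leP (- beta) c.
  have Mc' : - M1 < c by rewrite (lt_le_trans _ bc)// ltrN2.
  have tc : tau2 c = tau1 c by case: tE => // ce; rewrite ce ltxx in Mc'.
  apply: (no_low_crossing Mc' bc c0 t21).
  have cc : - M1 <= c <= 0 by rewrite !ltW.
  have r1 := cv_r0 (pr_tau Q1) cc; have s1 := cv_p0' (pr_tau Q1) cc.
  have : q1 c < q2 c.
    by move: q12; rewrite /momentum tc ltr_pM2l// exprn_gt0.
  rewrite /scaled_energy /energy tc expr1 => s12.
  rewrite ltr_pM2l ?exprn_gt0// ltrD2r ltr_pM2r ?invr_gt0// ltr_pXn2r//.
  by rewrite nnegrE (le_trans s1)// ltW.
have fall d : c < d -> d <= - beta -> d < 0 ->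
  (forall x, c < x <= d -> q1 x < q2 x /\ tau2 x < tau1 x) /\
  (d = - beta -> tau1 d * q1 d < tau2 d * q2 d).
  move=> cd db d0.
  have C1 := curve_sub Mc db (pr_fall Q1).
  have C2 := curve_sub (le_trans NM Mc) db (pr_fall Q2).
  have cb' := ltW cb.
  have cG := cont_sub (lexx c) db (fallF cb').
  have cK := cont_sub (lexx c) db (neg_quotient_cont reg sgn sup cb').
  have oo x : c < x < d -> c < x < - beta.
    by move=> /andP[-> h]; rewrite (lt_le_trans h).
  have p1d : 0 < q1 d by apply: (pr_fall_speed Q1); rewrite d0 (le_lt_trans Mc).
  have p2d : 0 < q2 d.
    by apply: (pr_fall_speed Q2); rewrite d0 (le_lt_trans (le_trans NM Mc)).
  have G0 x : c <= x <= d -> 0 <= Fneg x.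
    move=> /andP[_ xd]; have := le_trans xd db; rewrite le_eqVlt => /predU1P[->|xb].
      by rewrite /neg_primitive opprK (F_beta sgn).
    by rewrite ltW// (F_gt0 reg sgn)// ltrNr.
  have P0 x : c < x <= d -> 0 < pohozaev N Fneg Kneg tau1 q1 x.
    move=> /andP[cx xd]; apply: (pfall_gt0 Q1).
    by rewrite (le_trans Mc (ltW cx)) (le_trans xd).
  have hd x (h : c < x < d) := fallF' (oo x h).
  have hk x (h : c < x < d) := fallK' (oo x h).
  have kg x (h : c < x < d) := fallKf (oo x h).
  have k0 x (h : c < x < d) := fallK0 (oo x h).
  have g0 x (h : c < x < d) := fallf0 (oo x h).
  split.
    by move=> x /(falling_cmp cd C1 C2 cG cK hd hk kg k0 g0 p1d p2d G0 P0 t21 q12 (P12 cb'))[].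
  move=> de.
  apply: (falling_cmp_end cd C1 C2 cG cK hd hk kg k0 g0 p1d p2d G0 P0 t21 q12 (P12 cb')).
    by rewrite de /neg_primitive opprK (F_beta sgn).
  by rewrite de /neg_quotient opprK (K_beta sgn) oppr0.
move: beta0; rewrite le_eqVlt => /predU1P[be|bpos].
  have C1 := curve_sub Mc (lexx 0) (pr_tau Q1).
  have C2 := curve_sub (le_trans NM Mc) (lexx 0) (pr_tau Q2).
  have := curve_gap c0 C1 C2; rewrite (pr_tau0 Q1) (pr_tau0 Q2) subrr => H.
  have : tau1 c - tau2 c < 0.
    apply: H => x /andP[cx x0].
    have [|h _] := fall x cx _ x0; first by rewrite -be oppr0 ltW.
    by case: (h x) => //; rewrite cx lexx.
  by rewrite subr_lt0 ltNge t21.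
have Nb0 : - beta < 0 by rewrite oppr_lt0.
have [h /(_ erefl) E] := fall _ cb (lexx _) Nb0.
have [|s12 t21b] := h (- beta); first by rewrite cb lexx.
have Mb : - M1 < - beta by rewrite ltrN2.
apply: (no_low_crossing Mb (lexx _) Nb0 (ltW t21b)).
have bb : - M1 <= - beta <= 0 by rewrite !ltW.
have bb2 : - M2 <= - beta <= 0 by rewrite (le_trans NM) ltW.
have r1 := cv_r0 (pr_tau Q1) bb; have s1 := cv_p0' (pr_tau Q1) bb.
have r2 := cv_r0 (pr_tau Q2) bb2; have s2 := cv_p0' (pr_tau Q2) bb2.
have : (tau1 (- beta) * q1 (- beta)) ^+ 2 < (tau2 (- beta) * q2 (- beta)) ^+ 2.
  by rewrite ltr_pXn2r// nnegrE mulr_ge0// ltW.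
rewrite /scaled_energy /energy /neg_primitive opprK (F_beta sgn) !addr0 !expr1 !exprMn.
by lra.
Qed.

End Two.

End Conclusion.

Unset Implicit Arguments.

Theorem theorem1p1 (R : realType) (n : nat) (f : R -> R) (B beta : R) :
  (2 <= n)%N ->
  regular_nonlinearity f ->
  sign_condition f B beta ->
  subcritical n f beta ->
  superlinear f B beta ->
  forall a b : R, 0 < a -> a < b ->
  forall u v : R -> R,
    positive_solution n f a b u -> positive_solution n f a b v ->
    forall r : R, a <= r <= b -> u r = v r.
Proof.
case: n => [//|[//|N]] _ reg sgn sub sup a b a0 ab u v.
move=> /positive_solution_sol[du Su] /positive_solution_sol[dv Sv].
have [m [rho [tau Qu]]] := sol_profile reg sgn a0 ab Su.
have [l [eta [zeta Qv]]] := sol_profile reg sgn a0 ab Sv.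
have [lt|gt|eq] := ltgtP (du a) (dv a).
- by case: (profiles_absurd reg sgn a0 ab sub sup Qu Qv lt).
- by case: (profiles_absurd reg sgn a0 ab sub sup Qv Qu gt).
- exact: (sol_unique reg sgn a0 ab Su Sv eq).
Qed.
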